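(* Let $\mathbf{P}$ be a $d$-dimensional complete simplicial toric variety and let $X\subset\mathbf{P}$ be a Cartier divisor defined by $f=0$, where $f\in S_\beta$. Then $$H^0(\mathbf{P},\Omega^d_{\mathbf{P}}(X))=\Bigl\{\frac{A\,\Omega_0}{f}: A\in S_{\beta-\beta_0}\Bigr\},$$ where $\beta_0=\sum_{i=1}^n\beta_i$ and $z_i\in S_{\beta_i}$.
   Context: Setting: $M$ is a free abelian group of rank $d$, $N=\operatorname{Hom}(M,\mathbf{Z})$, $\Sigma$ a rational simplicial complete $d$-dimensional fan in $N_{\mathbf{R}}$, $\rho_1,\dots,\rho_n$ its one-dimensional cones, $e_i\in N$ the primitive generator of $\rho_i$, and $\mathbf{P}=\mathbf{P}_\Sigma$ the associated toric variety over $\mathbf{C}$ with torus $\mathbf{T}$. $S=\mathbf{C}[z_1,\dots,z_n]$ is graded by $Cl(\Sigma)=\mathbf{Z}^n/\alpha(M)$, $\alpha(m)=(\langle m,e_i\rangle)_i$; $\beta_i=\deg z_i$ is the class of the $i$-th basis vector. $\mathbf{P}=U(\Sigma)/\mathbf{D}(\Sigma)$ where $\mathbf{D}(\Sigma)=\operatorname{Spec}\mathbf{C}[Cl(\Sigma)]\subset(\mathbf{C}^* )^n$ and $U(\Sigma)=\mathbf{A}^n\setminus\mathbf{V}(\prod_{\rho_i\not\subset\sigma}z_i:\sigma\in\Sigma)$; a nonzero $f\in S_\beta$ defines the divisor $X=\{f=0\}\subset\mathbf{P}$ of class $\beta$. $\Omega^p_{\mathbf{P}}$ is the sheaf of Zariski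 $p$-forms ($j_*\Omega^p_W$ for $j:W\to\mathbf{P}$ the smooth locus) and $\Omega^p_{\mathbf{P}}(X)=\Omega^p_{\mathbf{P}}\otimes\mathcal{O}_{\mathbf{P}}(X)$; its local sections are rational $p$-forms that become sections of $\Omega^p_{\mathbf{P}}$ after multiplication by a local equation of $X$. Rational forms on $\mathbf{P}$ are identified with their pullbacks to $U(\Sigma)$, written in $z_i,dz_i$; for $m\in M$ the character $t^m$ of $\mathbf{T}$ pulls back to $\prod_i z_i^{\langle m,e_i\rangle}$. Fix a $\mathbf{Z}$-basis $m_1,\dots,m_d$ of $M$. For $I=\{i_1,\dots,i_d\}\subset\{1,\dots,n\}$ with $d$ elements put $\det(e_I)=\det(\langle m_j,e_{i_k}\rangle_{1\le j,k\le d})$, $dz_I=dz_{i_1}\wedge\cdots\wedge dz_{i_d}$, $\widehat z_I=\prod_{i\notin I}z_i$ (the product $\det(e_I)\,dz_I$ does not depend on the ordering of $I$). Then $$\Omega_0=\sum_{|I|=d}\det(e_I)\,\widehat z_I\,dz_I .$$ *)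

(* Defs.v *)
From HB Require Import structures.
From mathcomp Require Import all_boot all_order all_algebra.
From mathcomp Require Import fraction complex mpoly.
From mathcomp Require Import boolp classical_sets cardinality reals.

Set Implicit Arguments.
Unset Strict Implicit.
Unset Printing Implicit Defensive.

Import Order.TTheory GRing.Theory Num.Theory.
Local Open Scope ring_scope.
Local Open Scope classical_set_scope.

(* In coordinates M = Z^d, N = Hom(M, Z) = Z^d and N_R = R^d, the pairing     *)
(* <m, v> between M and N (or between M_R and N_R) being the dot product.     *)
(* A further Z-basis m_1, ..., m_d of M is the list of rows of a matrix       *)
(* B : 'M[int]_d that is invertible over Z.                                   *)

Definition pairing (A : comNzRingType) (d : nat) (u v : 'rV[A]_d) : A :=
  \sum_j u 0 j * v 0 j.

Section Fans.
Context (R : realType) (d : nat).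

Definition toNR (v : 'rV[int]_d) : 'rV[R]_d := map_mx intr v.

Definition cone (s : seq 'rV[int]_d) : set 'rV[R]_d :=
  [set v | exists2 c : 'I_(size s) -> R, forall k, 0 <= c k
         & v = \sum_k c k *: toNR (tnth (in_tuple s) k)].

Definition rational_polyhedral (sigma : set 'rV[R]_d) :=
  exists s, sigma = cone s.

Definition strongly_convex (sigma : set 'rV[R]_d) :=
  forall v, sigma v -> sigma (- v) -> v = 0.

Definition is_face (tau sigma : set 'rV[R]_d) :=
  exists2 u : 'rV[R]_d, forall v, sigma v -> 0 <= pairing u v
    & tau = [set v | sigma v /\ pairing u v = 0].

Definition is_fan (Sigma : set (set 'rV[R]_d)) :=
  [/\ finite_set Sigma,
      forall sigma, Sigma sigma ->
        rational_polyhedral sigma /\ strongly_convex sigma,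
      forall sigma tau, Sigma sigma -> is_face tau sigma -> Sigma tau
    & forall sigma tau, Sigma sigma -> Sigma tau ->
        is_face (sigma `&` tau) sigma /\ is_face (sigma `&` tau) tau].

Definition simplicial (Sigma : set (set 'rV[R]_d)) :=
  forall sigma, Sigma sigma ->
    exists2 s : seq 'rV[int]_d, free (map toNR s) & sigma = cone s.

Definition complete (Sigma : set (set 'rV[R]_d)) :=
  forall v : 'rV[R]_d, exists2 sigma, Sigma sigma & sigma v.

Definition primitive (v : 'rV[int]_d) :=
  forall (k : nat) (w : 'rV[int]_d), v = w *+ k -> k = 1%N.

(* The rays of Sigma are the cones of Sigma of the form R_{>=0} v, v != 0     *)
(* (its members are strongly convex); distinct primitive vectors span         *)
(* distinct rays, so that e enumerates the rays without repetition.           *)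
Definition ray_generators (n : nat) (Sigma : set (set 'rV[R]_d))
    (e : 'I_n -> 'rV[int]_d) :=
  [/\ injective e,
      forall i, primitive (e i) /\ Sigma (cone [:: e i])
    & forall v, v != 0 -> Sigma (cone [:: v]) ->
        exists i, cone [:: v] = cone [:: e i]].

End Fans.

Section Toric.
Context (R : realType) (d n : nat).
Variables (Sigma : set (set 'rV[R]_d)) (e : 'I_n -> 'rV[int]_d).

Local Notation C := R[i].
Local Notation S := {mpoly C[n]}.
Local Notation Kz := {fraction {mpoly C[n]}}.
Local Notation "p %:F" := (FracField.tofrac p).

Definition alpha (m : 'rV[int]_d) : 'rV[int]_n := \row_i pairing m (e i).

(* A class in Cl(Sigma) = Z^n / alpha(M) is given by a representative         *)
(* b : Z^n; graded_part b is S_beta for beta the class of b, and depends on   *)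
(* that class only.                                                           *)
Definition graded_part (b : 'rV[int]_n) : set S :=
  [set f | forall a, a \in msupp f ->
     exists m, (\row_i (a i)%:Z) - b = alpha m].

Definition beta0 : 'rV[int]_n := const_mx 1.

Definition U : set ('I_n -> C) :=
  [set z | exists2 sigma, Sigma sigma
     & \prod_(i < n | ~~ `[< cone [:: e i] `<=` sigma >]) z i != 0].

(* P = U(Sigma) / D(Sigma), where D(Sigma) = Spec C[Cl(Sigma)] acts on S      *)
(* through the grading: the invariants are the elements of degree 0.  A point *)
(* of P is the class [z] of some z in U(Sigma), functions on P are identified *)
(* with their pullbacks to U(Sigma), and the sets {h != 0} with h homogeneous *)
(* form a basis of open sets of P.  So the function field of P, the local     *)
(* ring at [z] and its maximal ideal are made of the fractions of degree 0    *)
(* below.  In particular they contain the pullback of t^m, the Laurent        *)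
(* monomial with exponent alpha m.                                            *)
Definition function_field : set Kz :=
  [set x | exists b p q, [/\ graded_part b p, graded_part b q, q != 0
     & x = p%:F / q%:F]].

Definition local_ring (z : 'I_n -> C) : set Kz :=
  [set x | exists b p q, [/\ graded_part b p, graded_part b q, q.@[z] != 0
     & x = p%:F / q%:F]].

Definition max_ideal (z : 'I_n -> C) : set Kz :=
  [set x | exists b p q, [/\ graded_part b p, graded_part b q,
     p.@[z] = 0, q.@[z] != 0 & x = p%:F / q%:F]].

Definition nbhd_of (h : S) (z : 'I_n -> C) :=
  (exists b, graded_part b h) /\ h.@[z] != 0.

(* [z] is a smooth point: its local ring, which has dimension d, is regular,  *)
(* i.e. has a maximal ideal generated by d elements.                          *)
Definition smooth_point (z : 'I_n -> C) :=
  exists2 t : 'I_d -> Kz, forall j, max_ideal z (t j)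
    & forall x, max_ideal z x ->
        exists2 c : 'I_d -> Kz, forall j, local_ring z (c j)
          & x = \sum_j c j * t j.

(* The rational d-form \sum_(#|I| = d) w_I dz_I on A^n is represented by its  *)
(* coefficients w_I, with dz_I ordered by increasing indices.                 *)
Definition dsubset := {I : {set 'I_n} | #|I| == d}.
Definition dform := {ffun dsubset -> Kz^o}.

Definition idx (I : dsubset) (k : 'I_d) : 'I_n :=
  enum_val (cast_ord (esym (eqP (valP I))) k).

Definition pderiv (i : 'I_n) (x : Kz) : Kz :=
  let p := \n_(repr x) in let q := \d_(repr x) in
  (p^`M(i) * q - p * q^`M(i))%:F / (q ^+ 2)%:F.


Definition wedge_d (h : 'I_d -> Kz) : dform :=
  [ffun I : dsubset => \det (\matrix_(j < d, k < d) pderiv (idx I k) (h j))].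

(* The finite sums of forms g dh_1 /\ ... /\ dh_d with g and the h_j in A.    *)
Definition forms_over (A : set Kz) : set dform :=
  [set w | exists (r : nat) (g : 'I_r -> Kz) (h : 'I_r -> 'I_d -> Kz),
     [/\ forall l, A (g l), forall l j, A (h l j)
       & w = \sum_l g l *: wedge_d (h l)]].

(* Pullbacks to U(Sigma) of the rational d-forms on P, and of those that are  *)
(* regular at a smooth point [z].                                             *)
Definition rational_dform : set dform := forms_over function_field.
Definition regular_dform (z : 'I_n -> C) : set dform :=
  forms_over (local_ring z).

(* Sections of Omega^d_P = j_* Omega^d_W on the open set {h != 0} of P, for   *)
(* j : W -> P the smooth locus.                                               *)
Definition zariski_dform (h : S) : set dform :=
  [set w | rational_dform w /\
     forall z, U z -> h.@[z] != 0 -> smooth_point z -> regular_dform z w].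

Definition regular_unit (z : 'I_n -> C) : set Kz :=
  [set u | exists p q : S, [/\ p.@[z] != 0, q.@[z] != 0 & u = p%:F / q%:F]].

(* g is an equation on {h != 0} of the divisor X = {f = 0}: the divisor of g  *)
(* pulls back to that of f, i.e. g differs from f by a unit of the local ring *)
(* of A^n at each point.                                                      *)
Definition local_equation (f h : S) (g : Kz) :=
  function_field g /\
  forall z, U z -> h.@[z] != 0 ->
    exists2 u, regular_unit z u & g = f%:F * u.

Definition is_cartier (f : S) :=
  forall z, U z -> exists h g, nbhd_of h z /\ local_equation f h g.

(* H^0(P, Omega^d_P(X)) for X = {f = 0}.                                      *)
Definition H0_Omega_d (f : S) : set dform :=
  [set w | rational_dform w /\
     forall z, U z -> exists h g,
       [/\ nbhd_of h z, local_equation f h g & zariski_dform h (g *: w)]].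

(* Omega_0, for the basis of M given by the rows of B.                        *)
Definition Omega0 (B : 'M[int]_d) : dform :=
  [ffun I : dsubset =>
     (\det (\matrix_(j < d, k < d) pairing (row j B) (e (idx I k))))%:~R
       * (\prod_(i in ~: val I) 'X_i : S)%:F].

End Toric.

(* Main.v *)
(* Both sides are of the form x * Omega_0 with x homogeneous: the pullback of a
   degree 0 rational function h satisfies z_i dh/dz_i = sum_l c_l <m_l, e_i>
   with c_l of degree 0, whence dh_1 /\ ... /\ dh_d = det(c) / (z_1 ... z_n) * Omega_0.
   If x * Omega_0 is a section of the twisted sheaf, then f x is regular at every
   point of C^n with at most one zero coordinate, since such points lie in
   U(Sigma), have smooth image and admit a basis e_I containing the vanishing
   coordinate; hence f x is a polynomial A, of the right degree.
   Conversely, if the local ring at [z] is regular, counting functionals on the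
   cotangent space shows that { e_i : z_i = 0 } is part of a dual system of
   vectors: there are m_i in M with <m_i, e_j> = delta_ij on these indices.
   Completing them gives m_1, ..., m_d such that Omega_0 is a unit at z times
   dt^(m_1) /\ ... /\ dt^(m_d). *)
Require Import Defs.
From mathcomp Require Import all_boot all_order all_algebra.
From mathcomp Require Import fraction complex mpoly.
From mathcomp Require Import boolp classical_sets cardinality reals.
From mathcomp Require Import ring zify.

Set Implicit Arguments.
Unset Strict Implicit.
Unset Printing Implicit Defensive.

Import Order.TTheory GRing.Theory Num.Theory.
Local Open Scope ring_scope.

Local Notation "p %:F" := (FracField.tofrac p) : ring_scope.

(** * Rational functions regular outside codimension two *)

(** The quotient of [Omega0] by z_1 ... z_n is dlog t^(m_1) /\ ... /\ dlog t^(m_d), the invariant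
    form of the torus. This is why it generates the rational d-forms over the function field, and
    where the shift by [beta0] comes from. The obstacle is that smoothness speaks of generators of a
    maximal ideal, while the forms need a statement about the lattice, and a simplicial cone alone
    only gives vectors dual to the e_i up to a determinant. The link is the monoid of the characters
    regular at [z]: each of its irreducible elements, taken up to units, gives a derivation at [z],
    hence a linear form on the cotangent space. If some e_i with z_i = 0 had no dual vector,
    primitivity of e_i would give an irreducible element off all the axes, and so one independent
    form too many for a space spanned by d classes. *)

Lemma dvdp_locally (C : closedFieldType) (P Q : {poly C}) : Q != 0 ->
  (forall x, exists p q, q.[x] != 0 /\ P * q = p * Q) -> Q %| P.
Proof.
move=> Q0 H; set g := gcdp P Q.
have g0 : g != 0 by rewrite gcdp_eq0 negb_and Q0 orbT.
have cop : coprimep (Q %/ g) (P %/ g).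
  by rewrite coprimep_sym coprimep_div_gcd // Q0 orbT.
have eP : P = P %/ g * g by rewrite divpK // dvdp_gcdl.
have eQ : Q = Q %/ g * g by rewrite divpK // dvdp_gcdr.
(* A root x of Q / g is impossible: Q / g is coprime to P / g, so it divides the local denominator
   q, which would then vanish at x. *)
have s1 : size (Q %/ g) == 1%N.
  apply: contraT => /closed_rootP [x rx].
  have [p [q [qx e]]] := H x.
  have : P %/ g * q = p * (Q %/ g).
    by apply: (mulIf g0); rewrite mulrAC -eP e [in LHS]eQ mulrA.
  move=> e'; have : Q %/ g %| P %/ g * q by rewrite e' dvdp_mull.
  rewrite mulrC (Gauss_dvdpl _ cop) => /(dvdp_trans _) /= D.
  by move: qx; rewrite -[_ == 0]/(root q x) -dvdp_XsubCl D // dvdp_XsubCl.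
rewrite [X in X %| _]eQ [X in _ %| X]eP dvdp_mul2r //.
case/size_poly1P: s1 => c c0 ->.
by rewrite (eqp_dvdl _ (_ : _ %= 1)) ?dvd1p // -size_poly_eq1 size_polyC c0.
Qed.

Lemma eq_fracP (A : idomainType) (p q r s : A) : q != 0 -> s != 0 ->
  p%:F / q%:F = r%:F / s%:F <-> p * s = r * q.
Proof.
move=> q0 s0; split=> [/eqP|e]; last apply/eqP;
  by rewrite eqr_div ?tofrac_eq0 // -!tofracM tofrac_eq ?e // => /eqP.
Qed.

Section Lines.
Context (n : nat).

Lemma meval_at0 (F : comNzRingType) (p : {mpoly F[n]}) :
  p.@[fun=> 0] = p@_0.
Proof.
rewrite [p in LHS]mpolyE [p in RHS]mpolyE !raddf_sum /=; apply: eq_bigr => m _.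
rewrite mevalZ mcoeffZ mevalX mcoeffX; congr (_ * _).
have [->|/eqP m0] := eqVneq m 0%MM; first by rewrite big1 // => i _; rewrite mnm0E.
have /existsP[i mi] : [exists i, m i != 0%N].
  apply/contraT => /existsPn H; case: m0; apply/mnmP => i.
  by rewrite mnm0E; apply/eqP; have := H i; rewrite negbK.
by rewrite (bigD1 i) //= expr0n (negPf mi) mul0r.
Qed.

Definition line (F : comNzRingType) (u v : 'I_n -> F) (p : {mpoly F[n]}) :
  {poly F} := mmap (@polyC F) (fun i => (u i)%:P + (v i)%:P * 'X) p.

Lemma horner_line (F : comNzRingType) (u v : 'I_n -> F) p s :
  (line u v p).[s] = p.@[fun i => u i + s * v i].
Proof.
rewrite /line /mmap horner_sum mevalE; apply: eq_bigr => m _.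
rewrite hornerM hornerC /mmap1 horner_prod; congr (_ * _).
by apply: eq_bigr => i _; rewrite horner_exp !hornerE mulrC.
Qed.

Lemma deriv_line (F : comNzRingType) (u : 'I_n -> F) i p :
  (line u (fun j => (i == j)%:R) p)^`() =
  line u (fun j => (i == j)%:R) p^`M(i).
Proof.
rewrite /line.
elim/mpolyind: p => [|c m p _ _ IH]; first by rewrite mderiv0 !mmap0 deriv0.
rewrite mderivD !mmapD derivD IH; congr (_ + _).
rewrite mderivZ !mmapZ deriv_mulC mderivX mmapZ !mmapX; congr (_ * _) => {p c IH}.
rewrite /mmap1 (bigD1 i) //= [in RHS](bigD1 i) //= eqxx mul1r derivM.
set a := \prod_(_ < _ | _) _; set a' := \prod_(_ < _ | _) _.
have -> : a = (\prod_(j < n | j != i) u j ^+ m j)%:P.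
  rewrite rmorph_prod; apply: eq_bigr => j ji.
  by rewrite eq_sym (negPf ji) mul0r addr0 rmorphXn.
have -> : a' = (\prod_(j < n | j != i) u j ^+ m j)%:P.
  rewrite rmorph_prod; apply: eq_bigr => j ji.
  rewrite eq_sym (negPf ji) mul0r addr0 rmorphXn mnmBE mnm1E.
  by rewrite eq_sym (negPf ji) subn0.
rewrite derivC mulr0 addr0 deriv_exp derivD derivC derivX add0r mul1r.
by rewrite mnmBE mnm1E eqxx subn1 rmorph_nat -mulr_natl mulrA.
Qed.

(** Induction on the degree of a monomial with nonzero coefficient: in characteristic 0 some partial
    derivative keeps a nonzero coefficient in lower degree. At a point v where this derivative does
    not vanish, the restriction to the line through v in its direction is a nonzero polynomial in
    one variable. *)
Lemma mpoly_nonroot (F : numDomainType) (p : {mpoly F[n]}) : p != 0 ->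
  exists v, p.@[v] != 0.
Proof.
suff H m (q : {mpoly F[n]}) : q@_m != 0 -> exists v, q.@[v] != 0.
  rewrite -msupp_eq0; case E: (msupp p) => [|m l] // _; apply: (H m).
  by rewrite -mcoeff_msupp E mem_head.
elim: {m}(mdeg m) {-2}m (erefl (mdeg m)) q => [|k IH] m em q qm.
  exists (fun=> 0); rewrite meval_at0.
  by move/eqP: em; rewrite mdeg_eq0 => /eqP e; rewrite -e.
have /existsP[i mi] : [exists i, m i != 0%N].
  apply/contraT => /existsPn H; move/eqP: em.
  suff -> : m = 0%MM by rewrite mdeg0.
  by apply/mnmP => i; rewrite mnm0E; apply/eqP; have := H i; rewrite negbK.
have em' : m = (m - U_(i) + U_(i))%MM.
  by rewrite submK //; apply/mnm_lepP => j; rewrite mnm1E; case: eqP => // <-; rewrite lt0n.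
have [||v hv] := IH (m - U_(i))%MM _ q^`M(i).
- by move: em; rewrite {1}em' mdegD mdeg1 addn1 => -[].
- by rewrite mcoeff_mderiv -em' mulrn_eq0 negb_or.
have nz : line v (fun j => (i == j)%:R) q != 0.
  apply: contraNneq hv => e0; have := deriv_line v i q.
  rewrite e0 deriv0 => /esym/(congr1 (horner^~ 0)); rewrite horner_line horner0.
  by move=> <-; apply/eqP/meval_eq => j; rewrite mul0r addr0.
suff [s hs] : exists s : F, (line v (fun j => (i == j)%:R) q).[s] != 0.
  by rewrite horner_line in hs; exists (fun j => v j + s * (i == j)%:R).
apply/not_existsP => H.
set l := line _ _ _ in nz H.
have := @max_poly_roots _ l [seq k%:R | k <- iota 0 (size l)] nz.
rewrite size_map size_iota ltnn => X; suff : false by []; apply: X.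
  by apply/allP => s _; apply/contraT => /H.
by rewrite map_inj_uniq ?iota_uniq // => a b /eqP; rewrite eqr_nat => /eqP.
Qed.

Section GenericLine.
Context (F : numClosedFieldType) (v : 'I_n -> F).
Local Notation S := {mpoly F[n]}.

(** p(X + s v) as a polynomial in s over S: the base point of the line is generic, its direction is
    fixed. *)
Definition generic_line (p : S) : {poly S} :=
  mmap (polyC \o @mpolyC n F) (fun i => ('X_i)%:P + ((v i)%:MP)%:P * 'X) p.

Lemma map_generic_line u p : map_poly (meval u) (generic_line p) = line u v p.
Proof.
rewrite /generic_line /line /mmap rmorph_sum; apply: eq_bigr => m _ /=.
rewrite rmorphM /= map_polyC /= mevalC; congr (_ * _).
rewrite /mmap1 rmorph_prod; apply: eq_bigr => i _ /=.
by rewrite rmorphXn rmorphD rmorphM /= !map_polyC map_polyX /= mevalC mevalXU.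
Qed.

Lemma generic_line0 p : (generic_line p).[0] = p.
Proof.
rewrite /generic_line /mmap horner_sum [RHS]mpolyE; apply: eq_bigr => m _ /=.
rewrite hornerM hornerC mul_mpolyC; congr (_ *: _).
rewrite /mmap1 horner_prod mpolyXE_id; apply: eq_bigr => i _.
by rewrite horner_exp !hornerE.
Qed.

(* c may be 0, and is then not the leading coefficient. *)
Definition has_top (R : comNzRingType) k (c : R) (p : {poly R}) :=
  (size p <= k.+1)%N /\ p`_k = c.

Lemma has_topM (R : comNzRingType) k l (c d : R) p q :
  has_top k c p -> has_top l d q -> has_top (k + l) (c * d) (p * q).
Proof.
move=> [sp <-] [sq <-]; split.
  by apply: leq_trans (size_polyMleq p q) _; lia.
rewrite coefM (bigD1 (inord k)) //= inordK ?leq_addr // ?ltnS ?leq_addr //.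
rewrite addKn big1 ?addr0 // => i /eqP ik.
have [ki|] := ltnP k i; first by rewrite nth_default ?mul0r // (leq_trans sp).
rewrite leq_eqVlt => /orP[/eqP e|lt]; last first.
  by rewrite [X in _ * X]nth_default ?mulr0 // (leq_trans sq) // ltn_subRL ltn_add2r.
by case: ik; apply: val_inj; rewrite /= inordK ?ltnS ?leq_addr.
Qed.

Lemma has_top_mmap1 m :
  has_top (mdeg m) (\prod_i v i ^+ m i)%:MP
    (mmap1 (fun i => ('X_i)%:P + ((v i)%:MP)%:P * 'X) m : {poly S}).
Proof.
rewrite mdegE rmorph_prod /mmap1.
elim/big_rec3: _ => [|i a b c _ IH].
  by split; rewrite ?size_poly1 ?coef1.
apply: has_topM IH; elim: (m i) => [|k IHk].
  by rewrite !expr0 rmorph1; split; rewrite ?size_poly1 ?coef1.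
rewrite exprS rmorphM [X in has_top _ _ X]exprS -add1n; apply: has_topM IHk; split.
  apply: leq_trans (size_polyD _ _) _; rewrite geq_max.
  rewrite (leq_trans (size_polyC_leq1 _)) //=.
  by rewrite mul_polyC (leq_trans (size_scale_leq _ _)) ?size_polyX.
by rewrite coefD coefC coefCM coefX /= add0r mulr1.
Qed.

(** Only monomials of top degree reach the highest power of s, each through its value at v; so this
    coefficient does not involve the base point. *)
Lemma has_top_generic_line (p : S) :
  has_top (msize p).-1
   (\sum_(m <- msupp p | mdeg m == (msize p).-1) p@_m * \prod_i v i ^+ m i)%:MP
   (generic_line p).
Proof.
rewrite /generic_line /mmap; split.
  rewrite big_seq; apply: leq_trans (size_sum _ _ _) _; apply/bigmax_leqP_seq => m _ ms.
  rewrite mul_polyC; apply: leq_trans (size_scale_leq _ _) _.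
  by apply: leq_trans (has_top_mmap1 m).1 _; have := msize_mdeg_lt ms; lia.
rewrite coef_sum rmorph_sum [RHS]big_mkcond /= big_seq [RHS]big_seq.
apply: eq_bigr => m ms; rewrite coefCM; have [h1 h2] := has_top_mmap1 m.
case: eqP => [<-|ne]; first by rewrite h2 -mpolyCM.
rewrite nth_default ?mulr0 //; apply: leq_trans h1 _.
by have := msize_mdeg_lt ms; lia.
Qed.

End GenericLine.

(** The direction avoids the zeros of the top homogeneous part of p, which makes the leading
    coefficient in s a nonzero constant, and the coordinate hyperplanes, which later keeps two
    coordinates from vanishing together on a generic line. *)
Lemma generic_line_lead (F : numClosedFieldType) (p : {mpoly F[n]}) : p != 0 ->
  exists v, exists2 c, c != 0 & (forall i, v i != 0) /\
    has_top (msize p).-1 c%:MP (generic_line v p).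
Proof.
move=> p0.
pose t := \sum_(m <- msupp p | mdeg m == (msize p).-1) p@_m *: 'X_[m].
have t0 : t != 0.
  apply/eqP => /mpolyP/(_ (mlead p)).
  rewrite /t raddf_sum mcoeff0 /= big_mkcond (bigD1_seq (mlead p)) ?mlead_supp ?msupp_uniq //=.
  rewrite -(mlead_deg p0) eqxx big1 => [|m /negPf ne]; last first.
    by case: ifP => // _; rewrite mcoeffZ mcoeffX ne mulr0.
  by rewrite mcoeffZ mcoeffX eqxx mulr1 addr0 => /eqP; rewrite mleadc_eq0 (negPf p0).
have X0 : \prod_(i < n) 'X_i != 0 :> {mpoly F[n]}.
  apply/prodf_neq0 => i _; apply/eqP => /mpolyP/(_ U_(i)%MM) /eqP.
  by rewrite mcoeffX eqxx mcoeff0 oner_eq0.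
have [v] := mpoly_nonroot (mulf_neq0 t0 X0).
rewrite mevalM mulf_eq0 negb_or => /andP[hv1 hv2].
exists v, t.@[v] => //; split.
  move: hv2; rewrite rmorph_prod => /prodf_neq0 H i.
  by have := H i isT; rewrite /= mevalXU.
have := has_top_generic_line v p; congr (has_top _ _ _); congr _%:MP.
by rewrite rmorph_sum; apply: eq_bigr => m _ /=; rewrite mevalZ mevalX.
Qed.

(* Along the line u + s v, with v fixed and u generic, no two coordinates
   vanish simultaneously, so Q divides P there.  As Q has a constant leading
   coefficient in s, P = A Q + r holds with polynomial A and r of lower degree
   in s, and r vanishes for generic u. *)
Lemma regular_off_codim2 (F : numClosedFieldType) (x : {fraction {mpoly F[n]}}) :
  (forall z : 'I_n -> F, (forall i j, z i = 0 -> z j = 0 -> i = j) ->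
     exists p q, q.@[z] != 0 /\ x = p%:F / q%:F) ->
  exists p, x = p%:F.
Proof.
move=> H; have [P [Q [Q0 ex]]] : exists P Q : {mpoly F[n]}, Q != 0 /\ x = P%:F / Q%:F.
  have [|p [q [qz ->]]] := H (fun=> 1); first by move=> i j /eqP; rewrite oner_eq0.
  by exists p, q; split=> //; apply: contraNneq qz => ->; rewrite meval0.
have [v [c c0 [v0 [sQ lQ]]]] := generic_line_lead Q0.
set D := (msize Q).-1 in sQ lQ.
have szQ : size (generic_line v Q) = D.+1.
  apply/eqP; rewrite eqn_leq sQ ltnNge; apply: contra c0 => sz.
  by move: lQ; rewrite nth_default // => /esym/eqP; rewrite mpolyC_eq0.
(* Dividing by the constant c makes the divisor monic, so that the quotient A has coefficients in
   the polynomial ring. *)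
pose M : {poly {mpoly F[n]}} := (c^-1)%:MP *: generic_line v Q.
have mM : M \is monic.
  rewrite monicE /lead_coef size_scale ?mpolyC_eq0 ?invr_eq0 //.
  by rewrite coefZ szQ lQ -mpolyCM mulVf.
have szM : size M = D.+1 by rewrite size_scale ?mpolyC_eq0 ?invr_eq0.
have [A [r [eP sr]]] : exists A r : {poly {mpoly F[n]}}, generic_line v P = A * M + r /\
  (size r < size M)%N.
  exists (Pdiv.Ring.rdivp (generic_line v P) M), (Pdiv.Ring.rmodp (generic_line v P) M).
  by rewrite -Pdiv.RingMonic.rdivp_eq // Pdiv.Ring.ltn_rmodp monic_neq0.
suff r0 : r = 0.
  exists ((c^-1)%:MP * A.[0]); rewrite ex; apply/(canLR (mulfK _)).
    by rewrite tofrac_eq0.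
  rewrite -rmorphM /=; congr _%:F; have := congr1 (horner^~ 0) eP.
  have [h1 h2] := (generic_line0 v P, generic_line0 v Q).
  rewrite r0 addr0 hornerM hornerZ {1}h1 h2 => ->.
  by rewrite mulrCA mulrA.
apply/eqP; apply: contraT => r0.
(* If coordinates i and j of u + s v both vanish, then u_i v_j = u_j v_i; a nonzero value of [T] at
   u excludes this for all s. *)
pose T : {mpoly F[n]} := \prod_i \prod_(j | j != i) ('X_i * (v j)%:MP - 'X_j * (v i)%:MP).
have T_neq0 : T != 0.
  apply/prodf_neq0 => i _; apply/prodf_neq0 => j ji.
  apply/eqP => /mpolyP/(_ U_(i)%MM); rewrite mcoeff0 mcoeffB ![_ * _%:MP]mulrC !mcoeffCM !mcoeffX.
  by rewrite eqxx mulr1 eq_mnm1 (negPf ji) mulr0 subr0 => /eqP; rewrite (negPf (v0 j)).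
have l0 : lead_coef r != 0 by rewrite lead_coef_eq0.
have [u] := mpoly_nonroot (mulf_neq0 l0 T_neq0).
rewrite mevalM mulf_eq0 negb_or => /andP[lu].
rewrite rmorph_prod => /prodf_neq0 Tu; case/eqP: lu.
have szl : size (line u v Q) = D.+1.
  have := map_generic_line v u Q.
  have -> : generic_line v Q = c%:MP *: M by rewrite scalerA -mpolyCM mulfV // scale1r.
  rewrite map_polyZ /= mevalC => <-; rewrite size_scale // -szM.
  by rewrite size_map_poly_id0 // (eqP mM) meval1 oner_eq0.
have : line u v Q %| line u v P.
  apply: dvdp_locally => [|s]; first by rewrite -size_poly_eq0 szl.
  have [i j /= ui uj|p [q [qz e]]] := H (fun i => u i + s * v i).
    apply: contraTeq isT => ij; have := Tu i isT.
    rewrite /= rmorph_prod => /prodf_neq0/(_ j); rewrite eq_sym => /(_ ij).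
    rewrite /= !(mevalB, mevalM) !mevalC !mevalXU.
    move/eqP: ui; move/eqP: uj; rewrite !addr_eq0 => /eqP -> /eqP ->.
    by case/eqP; ring.
  exists (line u v p), (line u v q); rewrite horner_line; split=> //.
  rewrite /line -!rmorphM; congr (mmap _ _ _).
  have q0 : q != 0 by apply: contraNneq qz => ->; rewrite meval0.
  by apply: (proj1 (eq_fracP P p Q0 q0)); rewrite -ex.
rewrite -!map_generic_line eP rmorphD rmorphM /= map_polyZ /= mevalC -mul_polyC => dv.
have {dv} : line u v Q %| map_poly (meval u) r.
  rewrite -map_generic_line; move: dv; set a := map_poly _ _ => dv.
  by rewrite -(dvdp_addr _ (_ : a %| map_poly (meval u) A * ((c^-1)%:P * a))) // mulrA dvdp_mull.
(* Where [lead_coef r] does not vanish, r keeps its degree, which is too small for divisibility. *)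
move/dvdp_leq => dv; apply/eqP; apply: contraT => lu.
have rsz : size (map_poly (meval u) r) = size r.
  by rewrite size_map_poly_id0.
have nz : map_poly (meval u) r != 0 by rewrite -size_poly_eq0 rsz size_poly_eq0.
by move: (dv nz); rewrite rsz szl -szM leqNgt sr.
Qed.

End Lines.

(** * Rays and bases of the lattice *)

Section Pairing.
Context (A : comNzRingType) (d : nat).
Implicit Types u v w : 'rV[A]_d.

Lemma pairingE u v : pairing u v = (u *m v^T) 0 0.
Proof. by rewrite mxE; apply: eq_bigr => j _; rewrite mxE. Qed.

Lemma pairingDl u v w : pairing (u + v) w = pairing u w + pairing v w.
Proof. by rewrite !pairingE mulmxDl mxE. Qed.

Lemma pairingZl a u v : pairing (a *: u) v = a * pairing u v.
Proof. by rewrite !pairingE -scalemxAl mxE. Qed.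

Lemma pairingZr a u v : pairing u (a *: v) = a * pairing u v.
Proof. by rewrite !pairingE linearZ /= -scalemxAr mxE. Qed.

Lemma pairing0l v : pairing 0 v = 0.
Proof. by rewrite pairingE mul0mx mxE. Qed.

Lemma pairingNl u v : pairing (- u) v = - pairing u v.
Proof. by rewrite !pairingE mulNmx mxE. Qed.

Lemma pairing_suml I (r : seq I) (P : pred I) (F : I -> 'rV[A]_d) v :
  pairing (\sum_(i <- r | P i) F i) v = \sum_(i <- r | P i) pairing (F i) v.
Proof. by rewrite pairingE mulmx_suml summxE; apply: eq_bigr => i _; rewrite pairingE. Qed.

Lemma pairing_sumr I (r : seq I) (P : pred I) (F : I -> 'rV[A]_d) u :
  pairing u (\sum_(i <- r | P i) F i) = \sum_(i <- r | P i) pairing u (F i).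
Proof.
rewrite pairingE linear_sum mulmx_sumr summxE.
by apply: eq_bigr => i _; rewrite pairingE.
Qed.

Lemma pairing_row m (C : 'M[A]_(m, d)) j v : pairing (row j C) v = (C *m v^T) j 0.
Proof. by rewrite pairingE -row_mul mxE. Qed.

End Pairing.

Lemma primitive_neq0 d (v : 'rV[int]_d) : primitive v -> v != 0.
Proof. by move=> pv; apply/eqP => v0; have := pv 0%N 0; rewrite mulr0n => /(_ v0). Qed.

(** The Smith form of the column v has at most its first entry nonzero, so v is an integer a times
    the first column of a unimodular L, and primitivity forces a = 1 or a = -1. The rows of a L^-1
    form a basis of M adapted to v. *)
Lemma primitive_unimodular d (v : 'rV[int]_d) : primitive v ->
  exists2 C : 'M[int]_d, C \in unitmx &
    exists j0, forall j, pairing (row j C) v = (j == j0)%:R.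
Proof.
case: d v => [|d] v pv; first by have := primitive_neq0 pv; rewrite [v]thinmx0 eqxx.
have [L uL [R uR [s _ ev]]] := int_Smith_normal_form v^T.
set D := \matrix_(i, j) _ in ev.
have [a eDR] : exists a, D *m R = \col_j (if j == ord0 then a else 0).
  exists (s`_0 * R ord0 ord0); apply/matrixP => j k; rewrite !mxE big_ord1 (ord1 k) mxE.
  by rewrite -[in RHS]val_eqE mulrnAl /=; case: (nat_of_ord j =P 0%N) => [->|].
have vE j : v 0 j = L j ord0 * a.
  have /matrixP/(_ j 0) := ev; rewrite -mulmxA eDR [in LHS]mxE => ->; rewrite mxE.
  rewrite (bigD1 ord0) //= mxE eqxx big1 ?addr0 // => k /negPf k0.
  by rewrite mxE k0 mulr0.
have a1 : `|a|%N = 1%N.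
  apply: (pv _ (\row_j (L j ord0 * sgz a))); apply/rowP => j.
  by rewrite mulmxnE mxE vE {1}[a]intEsg mulrA -mulr_natr natz.
have aa : a * a = 1 by rewrite [a]intEsg a1 mulr1 -expr2 sqr_sg; case: eqP a1 => // ->.
exists (a *: invmx L).
  by rewrite unitmxZ ?unitmx_inv //; apply/unitrP; exists a.
exists ord0 => j; rewrite pairing_row ev -scalemxAl -mulmxA mulKmx // eDR !mxE.
by case: (j == ord0); rewrite ?mulr0.
Qed.

Lemma free_mapP (K : fieldType) (V : vectType K) (T : Type) (g : T -> V) (s : seq T) :
  reflect (forall k : 'I_(size s) -> K,
     \sum_i k i *: g (tnth (in_tuple s) i) = 0 -> forall i, k i = 0)
   (free (map g s)).
Proof.
have e (i : 'I_(size s)) : (map_tuple g (in_tuple s))`_i = g (tnth (in_tuple s) i).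
  by rewrite -tnth_nth tnth_map.
apply: (iffP (freeP (X := map_tuple g (in_tuple s)))) => H k k0;
  by apply: H; rewrite -[RHS]k0; apply: eq_bigr => i _; rewrite e.
Qed.

Lemma idx_inj d n (I : dsubset d n) : injective (idx I).
Proof. by move=> j k /enum_val_inj/cast_ord_inj. Qed.

Lemma mem_idx d n (I : dsubset d n) i :
  (i \in [seq idx I k | k <- enum 'I_d]) = (i \in val I).
Proof.
apply/mapP/idP => [[k _ ->]|iI]; first exact: enum_valP.
exists (cast_ord (eqP (valP I)) (enum_rank_in iI i)); first by rewrite mem_enum.
by rewrite /idx cast_ordK enum_rankK_in.
Qed.

(** * Rays and cones of a complete simplicial fan *)

Section FanGeometry.
Context (R : realType) (d : nat).
Implicit Types (v : 'rV[int]_d) (s : seq 'rV[int]_d).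
Local Notation toN := (@toNR R d).

Lemma pairing_toNR (u v : 'rV[int]_d) : pairing (toN u) (toN v) = (pairing u v)%:~R.
Proof. by rewrite rmorph_sum; apply: eq_bigr => j _; rewrite !mxE rmorphM. Qed.

Lemma toNR_eq0 v : (toN v == 0) = (v == 0).
Proof.
apply/eqP/eqP => [/rowP e|->]; last by apply/rowP => j; rewrite !mxE.
by apply/rowP => j; have := e j; rewrite !mxE => /eqP; rewrite intr_eq0 => /eqP.
Qed.

Lemma cone1P v w : cone (R := R) [:: v] w <-> exists2 c, 0 <= c & w = c *: toN v.
Proof.
split=> [[c c0 ->]|[c c0 ->]].
  by exists (c ord0); rewrite // big_ord1 (tnth_nth 0).
by exists (fun=> c); rewrite // big_ord1 (tnth_nth 0).
Qed.

Lemma cone1_self v : cone (R := R) [:: v] (toN v).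
Proof. by apply/cone1P; exists 1; rewrite ?scale1r. Qed.

Lemma cone_mem s (k : 'I_(size s)) : cone (R := R) s (toN (tnth (in_tuple s) k)).
Proof.
exists (fun j => (j == k)%:R); first by move=> j; rewrite ler0n.
by rewrite (bigD1 k) //= eqxx scale1r big1 ?addr0 // => j /negPf ->; rewrite scale0r.
Qed.

(** A primitive vector pairs to 1 with some element of M. Hence c is an integer with an integer
    inverse, and c > 0 leaves only 1. *)
Lemma primitive_ray_inj v w (c : R) : primitive v -> primitive w -> 0 < c ->
  toN v = c *: toN w -> v = w.
Proof.
move=> pv pw c0 e.
have bez (u : 'rV[int]_d) : primitive u -> exists m, pairing m u = 1.
  by case/primitive_unimodular => C _ [j0 H]; exists (row j0 C); rewrite H eqxx.
have [[m hm] [m' hm']] := (bez _ pv, bez _ pw).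
have ec : c = (pairing m' v)%:~R.
  by rewrite -pairing_toNR e pairingZr pairing_toNR hm' mulr1.
have e1 : pairing m' v * pairing m w = 1.
  apply: (@intr_inj R); rewrite rmorphM /= -ec -[(pairing m w)%:~R]pairing_toNR -pairingZr -e.
  by rewrite pairing_toNR hm.
have c1 : c = 1.
  move: e1 ec; set a := pairing m' v; set k := pairing m w => e1 ec.
  have a0 : 0 < a by rewrite -(ltr0z R) -ec.
  have /eqP := congr1 absz e1; rewrite abszM absz1 muln_eq1 => /andP[/eqP a1 _].
  by rewrite ec -[a]gtz0_abs // a1.
apply/rowP => j; have /rowP/(_ j) := e; rewrite c1 scale1r !mxE.
exact: intr_inj.
Qed.

Lemma free_scaled_sub (I : Type) (l : seq I) (E : I -> 'rV[int]_d) s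
    (k : 'I_(size l) -> 'I_(size s)) (c : 'I_(size l) -> R) :
  free (map toN s) -> (forall i, c i != 0) -> injective k ->
  (forall i, toN (E (tnth (in_tuple l) i)) = c i *: toN (tnth (in_tuple s) (k i))) ->
  free [seq toN (E i) | i <- l].
Proof.
move=> /free_mapP fs c0 kinj Ec; apply/free_mapP => a sum0 i.
pose K (j : 'I_(size s)) := \sum_(i | k i == j) a i * c i.
have /fs/(_ (k i)) : \sum_j K j *: toN (tnth (in_tuple s) j) = 0.
  rewrite -[RHS]sum0 [RHS](partition_big k xpredT) //=.
  apply: eq_bigr => j _; rewrite scaler_suml; apply: eq_bigr => i' /eqP <-.
  by rewrite Ec scalerA.
rewrite /K (bigD1 i) //= big1 ?addr0 => [/eqP|i' /andP[/eqP/kinj ->]]; last by rewrite eqxx.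
by rewrite mulf_eq0 (negPf (c0 _)) orbF => /eqP.
Qed.

Lemma free_extend (V : vectType R) (n : nat) (E : 'I_n -> V) (l : seq 'I_n) :
  free (map E l) -> (<<map E (enum 'I_n)>> = fullv)%VS ->
  exists l', [/\ {subset l <= l'}, free (map E l') & size l' = \dim {:V}].
Proof.
move=> fl full.
suff [l' [sub fl' sp]] : exists l', [/\ {subset l <= l'}, free (map E l') &
    {subset map E (enum 'I_n) <= <<map E l'>>%VS}].
  exists l'; split=> //; move: fl'; rewrite /free size_map => /eqP <-; congr (\dim _).
  by apply/eqP; rewrite eqEsubv subvf -full; apply/span_subvP.
elim: (enum 'I_n) => [|i r [l' [sub fl' sp]]]; first by exists l; split.
have [ein|enin] := boolP (E i \in <<map E l'>>%VS).
  by exists l'; split=> // x; rewrite inE => /orP[/eqP ->|/sp].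
exists (i :: l'); split; first by move=> x /sub; rewrite inE => ->; rewrite orbT.
  by rewrite /= free_cons enin.
move=> x; rewrite inE => /orP[/eqP ->|/sp]; first by rewrite memv_span ?mem_head.
by apply/subvP; apply: sub_span => y; rewrite inE => ->; rewrite orbT.
Qed.

Section Fan.
Context (n : nat) (Sigma : set (set 'rV[R]_d)) (e : 'I_n -> 'rV[int]_d).
Hypotheses (fanS : is_fan Sigma) (simpS : simplicial Sigma)
  (compS : complete Sigma) (rayS : ray_generators Sigma e).
Local Open Scope classical_set_scope.

Lemma ray_primitive i : primitive (e i).
Proof. by case: rayS => _ /(_ i) []. Qed.

(* The ray is a face of the cone by the fan axiom, so the linear form that
   cuts it out vanishes on a generator. *)
Lemma ray_in_simplicial_cone i s : Sigma (cone s) -> free (map toN s) ->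
  cone [:: e i] `<=` cone (R := R) s ->
  exists k : 'I_(size s), exists2 c, 0 < c & toN (e i) = c *: toN (tnth (in_tuple s) k).
Proof.
move=> Ss fs sub.
have [_ /(_ i) [pe Se] _] := rayS; have [_ _ _ /(_ _ _ Se Ss) [_]] := fanS.
rewrite (setIidl sub) => -[u upos face].
have [ei ue] : cone s (toN (e i)) /\ pairing u (toN (e i)) = 0.
  by have := cone1_self (e i); rewrite face.
have [c c0 ec] := ei.
have up k : 0 <= pairing u (toN (tnth (in_tuple s) k)) by apply/upos/cone_mem.
have z k : c k * pairing u (toN (tnth (in_tuple s) k)) = 0.
  move: ue; rewrite ec pairing_sumr => /eqP.
  rewrite psumr_eq0; last by move=> j _; rewrite pairingZr mulr_ge0.
  by move/allP/(_ k); rewrite mem_index_enum pairingZr => /(_ isT)/eqP.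
have [k ck] : exists k, c k != 0.
  apply/not_existsP => H; have := primitive_neq0 pe; rewrite -toNR_eq0 ec.
  rewrite big1 ?eqxx // => k _; have /negP := H k; rewrite negbK => /eqP ->.
  by rewrite scale0r.
have /cone1P [c' c'0 ek] : cone [:: e i] (toN (tnth (in_tuple s) k)).
  rewrite face; split; first exact: cone_mem.
  by apply/eqP; have /eqP := z k; rewrite mulf_eq0 (negPf ck).
have c'p : 0 < c'.
  rewrite lt0r c'0 andbT; apply/eqP => c'z.
  have /free_not0/(_ (map_f _ (mem_tnth k (in_tuple s)))) := fs.
  by rewrite ek c'z scale0r eqxx.
exists k, c'^-1; first by rewrite invr_gt0.
by rewrite ek scalerA mulVf ?scale1r // gt_eqF.
Qed.

(** Each ray is spanned by a generator of the cone, and two primitive vectors on the same generator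
    are equal; so the e_i are nonzero multiples of distinct independent vectors. *)
Lemma free_rays_of_cone (sigma : set 'rV[R]_d) (l : seq 'I_n) : Sigma sigma -> uniq l ->
  (forall i, i \in l -> cone [:: e i] `<=` sigma) -> free [seq toN (e i) | i <- l].
Proof.
move=> Ss ul sub; have [s fs es] := simpS Ss; move: Ss sub; rewrite {sigma}es => Ss sub.
have H (i : 'I_(size l)) := ray_in_simplicial_cone Ss fs (sub _ (mem_tnth i (in_tuple l))).
pose k i := projT1 (cid (H i)); pose c i := projT1 (cid2 (projT2 (cid (H i)))).
have cP i : 0 < c i by rewrite /c; case: cid2.
have ecP i : toN (e (tnth (in_tuple l) i)) = c i *: toN (tnth (in_tuple s) (k i)).
  by rewrite /c; case: cid2.
apply: (free_scaled_sub fs _ _ ecP) => [i|a b kab]; first by rewrite gt_eqF.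
have ab : toN (e (tnth (in_tuple l) a)) =
    (c a / c b) *: toN (e (tnth (in_tuple l) b)).
  by rewrite !ecP kab scalerA mulfVK // gt_eqF.
have cab : 0 < c a / c b by rewrite divr_gt0.
case: rayS => einj _ _; apply: (tuple_uniqP (in_tuple l) ul).
apply: einj; apply: (primitive_ray_inj _ _ cab ab); exact: ray_primitive.
Qed.

Lemma ray_is_face s (k : 'I_(size s)) : free (map toN s) ->
  is_face (R := R) (cone [:: tnth (in_tuple s) k]) (cone s).
Proof.
move=> /free_mapP fs; pose A := \matrix_(j < size s) toN (tnth (in_tuple s) j).
have fA : row_free A.
  apply: inj_row_free => v vA; apply/rowP => j; rewrite mxE.
  apply: (fs (fun j => v 0 j)); rewrite -[RHS]vA mulmx_sum_row.
  by apply: eq_bigr => j' _; rewrite rowK.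
(* By independence of the generators [pinvmx A] is a right inverse of [A], which gives a form equal
   to 0 on the k-th generator and to 1 on all the others. *)
pose u := (pinvmx A *m \col_j (j != k)%:R)^T.
have uE j : pairing u (toN (tnth (in_tuple s) j)) = (j != k)%:R.
  rewrite pairingE -[toN _](rowK (fun j => toN (tnth (in_tuple s) j))) -/A.
  by rewrite -trmx_mul mxE -row_mul mulmxA mulmxVp // mul1mx !mxE.
have ucone c : pairing u (\sum_j c j *: toN (tnth (in_tuple s) j)) =
    \sum_(j | j != k) c j.
  rewrite pairing_sumr [RHS]big_mkcond; apply: eq_bigr => j _.
  by rewrite pairingZr uE mulr_natr mulrb.
exists u => [v [c c0 ->]|]; first by rewrite ucone sumr_ge0.
apply/seteqP; split=> v.
  move=> /cone1P [c c0 ->]; split; last by rewrite pairingZr uE eqxx mulr0.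
  exists (fun j => c * (j == k)%:R); first by move=> j; rewrite mulr_ge0 ?ler0n.
  rewrite (bigD1 k) //= eqxx mulr1 big1 ?addr0 // => j /negPf ->.
  by rewrite mulr0 scale0r.
move=> /= [[c c0 ->]]; rewrite ucone => /eqP; rewrite psumr_eq0 // => /allP cz.
apply/cone1P; exists (c k) => //.
rewrite (bigD1 k) //= big1 ?addr0 // => j jk.
by have := cz j; rewrite mem_index_enum jk => /(_ isT)/eqP ->; rewrite scale0r.
Qed.

(** By completeness each vector lies in a simplicial cone, whose generators span faces of it, hence
    rays of the fan, hence are multiples of some e_i. *)
Lemma rays_span : (<<[seq toN (e i) | i <- enum 'I_n]>> = fullv)%VS.
Proof.
apply/eqP; rewrite eqEsubv subvf; apply/subvP => v _.
have [sigma Ss] := compS v.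
have [s fs es] := simpS Ss; move: Ss; rewrite {}es => Ss [c c0 ->].
apply: memv_suml => k _; apply: memvZ.
have [_ _ faceS _] := fanS; have Sk := faceS _ _ Ss (ray_is_face k fs).
have sk0 : tnth (in_tuple s) k != 0.
  rewrite -toNR_eq0; apply: free_not0 fs _.
  exact: map_f (mem_tnth k (in_tuple s)).
have [_ _ /(_ _ sk0 Sk) [i ei]] := rayS.
have := cone1_self (tnth (in_tuple s) k); rewrite ei => /cone1P [a _ ->].
by apply: memvZ; apply: memv_span; apply: map_f; rewrite mem_enum.
Qed.

(** Up to [\det B], this determinant is the constant in the coefficient of [Omega0] at I. When l
    lists the vanishing coordinates of z, that coefficient is nonzero at z, as its monomial only
    involves indices outside I. *)
Lemma extend_to_basis (l : seq 'I_n) : free [seq toN (e i) | i <- l] ->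
  exists I : dsubset d n, {subset l <= val I} /\
    \det (\matrix_(k < d, j < d) e (idx I k) 0 j) != 0.
Proof.
move=> fl; have [l' [sub fl' sl']] := free_extend fl rays_span.
have ul' : uniq l' by apply: map_uniq (free_uniq fl').
have cI : #|[set i in l']| == d.
  by rewrite cardsE (card_uniqP ul') sl' dimvf dim_matrix mul1r.
pose I : dsubset d n := exist _ [set i in l'] cI.
exists I; split; first by move=> i /sub; rewrite inE.
set M := \matrix_(_, _) _.
have fI : free [tuple toN (e (idx I k)) | k < d].
  rewrite (_ : tval _ = [seq toN (e i) | i <- [seq idx I k | k <- enum 'I_d]]); last first.
    by rewrite -map_comp -val_ord_tuple.
  rewrite (perm_free (Y := [seq toN (e i) | i <- l'])) //; apply: perm_map.
  apply: uniq_perm => // [|i]; first by rewrite map_inj_uniq ?enum_uniq //; apply: idx_inj.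
  by rewrite mem_idx inE.
have : \det (map_mx (intr : int -> R) M) != 0; last first.
  by apply: contraNneq => M0; rewrite det_map_mx M0.
apply/det0P => -[v /eqP v0 vM]; apply: v0; apply/rowP => k; rewrite mxE.
apply: (freeP fI (fun k => v 0 k)); rewrite -[RHS]vM mulmx_sum_row.
apply: eq_bigr => k' _; rewrite -tnth_nth tnth_mktuple; congr (_ *: _).
by apply/rowP => j; rewrite !mxE.
Qed.

Lemma one_zero_in_U (z : 'I_n -> R[i]) :
  (forall i j, z i = 0 -> z j = 0 -> i = j) -> U Sigma e z.
Proof.
move=> H; have [[i zi]|Hn] := pselect (exists i, z i = 0).
  have [_ /(_ i) [_ Si] _] := rayS; exists (cone [:: e i]) => //.
  apply/prodf_neq0 => j /negP nj; apply/eqP => zj; apply: nj; apply/asboolP.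
  by rewrite (H i j zi zj).
have [sigma Ss _] := compS 0; exists sigma => //.
by apply/prodf_neq0 => j _; apply/eqP => zj; apply: Hn; exists j.
Qed.

Lemma free_zeros (z : 'I_n -> R[i]) : U Sigma e z ->
  free [seq toN (e i) | i <- enum [pred i | z i == 0]].
Proof.
move=> [sigma Ss /prodf_neq0 H]; apply: (free_rays_of_cone Ss); first exact: enum_uniq.
move=> i; rewrite mem_enum inE => zi; apply/asboolP; apply: contraT => ni.
by have := H i ni; rewrite zi.
Qed.

End Fan.
End FanGeometry.

(** * Fractions: derivations and local rings *)

Lemma inv_deriv_eq (F : fieldType) (x a y : F) : x != 0 ->
  a * x^-1 = - (x * y) -> y = - a / x ^+ 2.
Proof.
move=> x0 e; apply: (mulfI x0); rewrite -[LHS]opprK -e.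
by field.
Qed.

Section FractionDerivation.
Context (A : idomainType) (D : A -> A).
Hypotheses (DD : {morph D : p q / p + q})
  (DM : forall p q, D (p * q) = D p * q + p * D q).

Lemma repr_frac (x : {fraction A}) :
  x = (\n_(repr x))%:F / (\d_(repr x))%:F.
Proof.
apply/(canRL (mulfK _)); first by rewrite tofrac_eq0 denom_ratioP.
rewrite -{1}[x]reprK; unlock FracField.tofrac; rewrite -[LHS]FracField.pi_mul.
apply/eqmodP; rewrite /= FracField.equivfE /FracField.mulf.
by rewrite !numden_Ratio ?mulf_neq0 ?oner_eq0 ?denom_ratioP //; apply/eqP; ring.
Qed.

(** The formula of [pderiv] for an arbitrary derivation D; its independence of the representative is
    [frac_derivE]. *)
Definition frac_deriv (x : {fraction A}) : {fraction A} :=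
  let p := \n_(repr x) in let q := \d_(repr x) in
  (D p * q - p * D q)%:F / (q ^+ 2)%:F.

Lemma frac_derivE p q : q != 0 ->
  frac_deriv (p%:F / q%:F) = (D p * q - p * D q)%:F / (q ^+ 2)%:F.
Proof.
move=> q0; rewrite /frac_deriv; have := repr_frac (p%:F / q%:F).
set r := repr _; set n := \n_r; set d := \d_r => e.
have d0 : d != 0 := denom_ratioP r.
have {}e := proj1 (eq_fracP _ _ q0 d0) e.
have e' : D p * d + p * D d = D n * q + n * D q by rewrite -!DM e.
apply/eq_fracP; rewrite ?expf_neq0 //; apply/eqP; rewrite -subr_eq0.
(* The two quotient rules differ by a combination of the relation p d = n q and of its
   derivative. *)
have -> : (D n * d - n * D d) * q ^+ 2 - (D p * q - p * D q) * d ^+ 2 =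
   d * q * ((D n * q + n * D q) - (D p * d + p * D d))
   + (p * d - n * q) * (D d * q + d * D q) by ring.
by rewrite e e' !subrr mulr0 mul0r addr0.
Qed.

Lemma fracP (x : {fraction A}) : exists p q, q != 0 /\ x = p%:F / q%:F.
Proof. by exists (\n_(repr x)), (\d_(repr x)); rewrite denom_ratioP -repr_frac. Qed.

Lemma frac_deriv_tofrac p : frac_deriv p%:F = (D p)%:F.
Proof.
have D1 : D 1 = 0.
  by have /eqP := DM 1 1; rewrite !mulr1 mul1r -subr_eq0 opprD addrA subrr sub0r oppr_eq0 => /eqP.
have := @frac_derivE p 1 (oner_neq0 _).
by rewrite tofrac1 !divr1 => ->; rewrite D1 mulr0 subr0 mulr1 expr1n tofrac1 divr1.
Qed.

Lemma frac_derivD x y : frac_deriv (x + y) = frac_deriv x + frac_deriv y.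
Proof.
have [[p [q [q0 ->]]] [r [s [s0 ->]]]] := (fracP x, fracP y).
have [q0' s0'] : q%:F != 0 /\ s%:F != 0 by rewrite !tofrac_eq0.
have -> : p%:F / q%:F + r%:F / s%:F = (p * s + r * q)%:F / (q * s)%:F.
  by rewrite addf_div // tofracD !tofracM.
rewrite !frac_derivE ?mulf_neq0 // addf_div ?tofrac_eq0 ?expf_neq0 //.
rewrite -!tofracM -tofracD; apply/eq_fracP; rewrite ?mulf_neq0 ?expf_neq0 //.
by rewrite !(DD, DM); ring.
Qed.

Lemma frac_derivM x y : frac_deriv (x * y) = frac_deriv x * y + x * frac_deriv y.
Proof.
have [[p [q [q0 ->]]] [r [s [s0 ->]]]] := (fracP x, fracP y).
have [q0' s0'] : q%:F != 0 /\ s%:F != 0 by rewrite !tofrac_eq0.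
have -> : p%:F / q%:F * (r%:F / s%:F) = (p * r)%:F / (q * s)%:F.
  by rewrite mulf_div !tofracM.
rewrite !frac_derivE ?mulf_neq0 // !mulf_div -!tofracM addf_div ?tofrac_eq0 ?mulf_neq0
  ?expf_neq0 //.
rewrite -!tofracM -tofracD; apply/eq_fracP; rewrite ?mulf_neq0 ?expf_neq0 //.
by rewrite !(DD, DM); ring.
Qed.

Lemma frac_derivV x : frac_deriv x^-1 = - frac_deriv x / x ^+ 2.
Proof.
have [->|x0] := eqVneq x 0.
  by rewrite invr0 expr2 mulr0 invr0 mulr0 -tofrac0 frac_deriv_tofrac;
     have /eqP := DD 0 0; rewrite !addr0 -subr_eq0 opprD addrA subrr sub0r oppr_eq0 => /eqP ->.
have := frac_derivM x x^-1; rewrite divff // -tofrac1 frac_deriv_tofrac.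
have := frac_deriv_tofrac 1; rewrite tofrac1; have := frac_derivM 1 1.
rewrite !mulr1 mul1r => e1 <- e2.
have d1 : frac_deriv 1 = 0.
  by move/eqP: e1; rewrite -subr_eq0 opprD addrA subrr sub0r oppr_eq0 => /eqP.
move/eqP: e2; rewrite d1 eq_sym addr_eq0 => /eqP e2.
exact: inv_deriv_eq x0 e2.
Qed.

End FractionDerivation.

Section Local.
Context (A : idomainType) (F : fieldType) (ev : {rmorphism A -> F}).
Implicit Types x y : {fraction A}.

(** The localisation of A at the kernel of [ev]. For evaluation at z it is the local ring of affine
    space, with no homogeneity imposed on p and q. *)
Definition regular x := exists p q, ev q != 0 /\ x = p%:F / q%:F.

Definition vanishing x := exists p q, [/\ ev p = 0, ev q != 0 & x = p%:F / q%:F].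

Lemma ev_neq0 q : ev q != 0 -> q != 0.
Proof. by apply: contraNneq => ->; rewrite rmorph0. Qed.

Lemma regular_tofrac p : regular p%:F.
Proof. by exists p, 1; rewrite rmorph1 oner_neq0 tofrac1 divr1. Qed.

Lemma regularD x y : regular x -> regular y -> regular (x + y).
Proof.
move=> [p [q [q0 ->]]] [r [s [s0 ->]]]; exists (p * s + r * q), (q * s).
rewrite rmorphM mulf_neq0 //; split=> //.
by rewrite addf_div ?tofrac_eq0 ?ev_neq0 // tofracD !tofracM.
Qed.

Lemma regularM x y : regular x -> regular y -> regular (x * y).
Proof.
move=> [p [q [q0 ->]]] [r [s [s0 ->]]]; exists (p * r), (q * s).
by rewrite rmorphM mulf_neq0 // mulf_div !tofracM.
Qed.

Lemma regular_sum (I : Type) (r : seq I) (P : pred I) (f : I -> {fraction A}) :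
  (forall i, P i -> regular (f i)) -> regular (\sum_(i <- r | P i) f i).
Proof.
move=> H; elim/big_ind: _ => //; last exact: regularD.
by rewrite -tofrac0; apply: regular_tofrac.
Qed.

Lemma regular_prod (I : Type) (r : seq I) (P : pred I) (f : I -> {fraction A}) :
  (forall i, P i -> regular (f i)) -> regular (\prod_(i <- r | P i) f i).
Proof.
move=> H; elim/big_ind: _ => //; last exact: regularM.
by rewrite -tofrac1; apply: regular_tofrac.
Qed.

Lemma regular_det m (M : 'M_m) : (forall i j, regular (M i j)) -> regular (\det M).
Proof.
move=> H; apply: regular_sum => s _; apply: regularM; last exact: regular_prod.
by rewrite -tofrac1 -tofracN -tofracXn; apply: regular_tofrac.
Qed.

Lemma vanishing_regular x : vanishing x -> regular x.
Proof. by move=> [p [q [_ ? ?]]]; exists p, q. Qed.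

Lemma vanishing_num p q : ev q != 0 -> vanishing (p%:F / q%:F) -> ev p = 0.
Proof.
move=> q0 [r [s [r0 s0 /eq_fracP]]]; rewrite !ev_neq0 // => /(_ isT isT).
move=> /(congr1 ev)/eqP; rewrite !rmorphM r0 mul0r mulf_eq0 (negPf s0) orbF.
by move/eqP.
Qed.

Lemma regular_frac_deriv (D : A -> A) : {morph D : p q / p + q} ->
  (forall p q, D (p * q) = D p * q + p * D q) ->
  forall x, regular x -> regular (frac_deriv D x).
Proof.
move=> DD DM x [p [q [q0 ->]]]; rewrite frac_derivE ?ev_neq0 //.
by exists (D p * q - p * D q), (q ^+ 2); rewrite rmorphXn expf_neq0.
Qed.

End Local.

(** * The grading and the function field *)

Section Graded.
Context (R : realType) (d n : nat) (e : 'I_n -> 'rV[int]_d).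
Local Notation C := R[i].
Local Notation S := {mpoly C[n]}.
Local Notation K := {fraction S}.
Local Notation gr := (graded_part (R := R) e).
Local Notation ff := (function_field (R := R) e).
Implicit Types (p q : S) (x y : K) (m : 'rV[int]_d) (z : 'I_n -> C).

Definition eval_at z : {rmorphism S -> C} := meval z.

Definition exponents (mu : 'X_{1..n}) : 'rV[int]_n := \row_i (mu i)%:Z.

Lemma exponentsD mu nu : exponents (mu + nu)%MM = exponents mu + exponents nu.
Proof. by apply/rowP => i; rewrite !mxE mnmDE PoszD. Qed.

Lemma alphaD m m' : alpha e (m + m') = alpha e m + alpha e m'.
Proof. by apply/rowP => i; rewrite !mxE pairingDl. Qed.

Lemma alphaN m : alpha e (- m) = - alpha e m.
Proof. by apply/rowP => i; rewrite !mxE pairingNl. Qed.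

Lemma alpha0 : alpha e 0 = 0.
Proof. by apply/rowP => i; rewrite !mxE pairing0l. Qed.

Definition in_class (b : 'rV[int]_n) (mu : 'X_{1..n}) :=
  exists m, exponents mu - b = alpha e m.

Lemma gradedE b p : gr b p <-> forall mu, mu \in msupp p -> in_class b mu.
Proof. by []. Qed.

Lemma gradedD b p q : gr b p -> gr b q -> gr b (p + q).
Proof.
move=> /gradedE hp /gradedE hq; apply/gradedE => mu /msuppD_le.
by rewrite mem_cat => /orP[/hp|/hq].
Qed.

Lemma gradedM b c p q : gr b p -> gr c q -> gr (b + c) (p * q).
Proof.
move=> /gradedE hp /gradedE hq; apply/gradedE => mu /msuppM_le /allpairsP[[m1 m2] /= [h1 h2 ->]].
have [[k1 e1] [k2 e2]] := (hp _ h1, hq _ h2).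
by exists (k1 + k2); rewrite alphaD -e1 -e2 exponentsD opprD addrACA.
Qed.

Lemma gradedX b mu : in_class b mu -> gr b 'X_[mu].
Proof. by move=> H; apply/gradedE => nu; rewrite msuppX inE => /eqP ->. Qed.

Lemma graded_mono mu : gr (exponents mu) 'X_[mu].
Proof. by apply: gradedX; exists 0; rewrite subrr alpha0. Qed.

Lemma gradedC (c : C) : gr 0 c%:MP.
Proof.
apply/gradedE => mu; rewrite msuppC; case: eqP => // _; rewrite inE => /eqP ->.
by exists 0; rewrite alpha0 subr0; apply/rowP => i; rewrite !mxE mnm0E.
Qed.

Definition component b p : S :=
  \sum_(mu <- msupp p | `[< in_class b mu >]) p@_mu *: 'X_[mu].

Lemma mcoeff_component b p mu :
  (component b p)@_mu = if `[< in_class b mu >] then p@_mu else 0.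
Proof.
rewrite /component raddf_sum /= big_mkcond /=.
rewrite (eq_bigr (fun nu => if nu == mu then (if `[< in_class b mu >] then p@_mu else 0)
  else 0)); last first.
  move=> nu _; case: eqP => [->|/eqP ne].
    by case: ifP => // _; rewrite mcoeffZ mcoeffX eqxx mulr1.
  by case: ifP => // _; rewrite mcoeffZ mcoeffX (negPf ne) mulr0.
have [mp|mp] := boolP (mu \in msupp p).
  by rewrite (bigD1_seq mu) ?msupp_uniq //= eqxx big1 ?addr0 // => nu /negPf ->.
rewrite big_seq_cond big1 => [|nu /andP[h _]]; first by rewrite (memN_msupp_eq0 mp) if_same.
by case: eqP h => // ->; rewrite (negPf mp).
Qed.

Lemma componentD b p q : component b (p + q) = component b p + component b q.
Proof.
by apply/mpolyP => mu; rewrite mcoeffD !mcoeff_component mcoeffD; case: ifP; rewrite ?addr0.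
Qed.

Lemma component_sum b (I : Type) (r : seq I) (f : I -> S) :
  component b (\sum_(i <- r) f i) = \sum_(i <- r) component b (f i).
Proof.
elim/big_rec2: _ => [|i p q _ <-]; last by rewrite componentD.
by rewrite /component msupp0 big_nil.
Qed.

Lemma componentZX b (c : C) mu :
  component b (c *: 'X_[mu]) = if `[< in_class b mu >] then c *: 'X_[mu] else 0.
Proof.
apply/mpolyP => nu; rewrite mcoeff_component; have [<-|ne] := eqVneq mu nu.
  by case: ifP; rewrite ?mcoeff0.
by rewrite (fun_if (mcoeff nu)) mcoeffZ mcoeffX (negPf ne) mulr0 mcoeff0 !if_same.
Qed.

Lemma in_classD b c mu nu : in_class c nu -> in_class (b + c) (mu + nu)%MM <-> in_class b mu.
Proof.
move=> [k ek]; split=> -[m em]; [exists (m - k)|exists (m + k)].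
  by rewrite alphaD alphaN -em -ek exponentsD; apply/rowP => i; rewrite !mxE; ring.
by rewrite alphaD -em -ek exponentsD opprD addrACA.
Qed.

(** A homogeneous factor only shifts the classes of monomials. An identity p s = r q with r and s
    homogeneous can thus be split into components. *)
Lemma componentM b c p q : gr c q -> component (b + c) (p * q) = component b p * q.
Proof.
move=> /gradedE hq; rewrite [in LHS](mpolyE p) [in X in _ = X * _](mpolyE p).
rewrite component_sum !mulr_suml component_sum; apply: eq_bigr => mu _.
rewrite [in LHS](mpolyE q) [in RHS](mpolyE q) mulr_sumr component_sum [RHS]mulr_sumr.
rewrite big_seq [RHS]big_seq; apply: eq_bigr => nu /hq hnu.
rewrite -scalerAl -scalerAr scalerA -mpolyXD !componentZX.
rewrite (asbool_equiv_eq (in_classD b mu hnu)).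
by case: ifP; rewrite ?mul0r // -scalerAl -scalerAr scalerA mpolyXD.
Qed.

Lemma graded_component b p : gr b (component b p).
Proof.
apply/gradedE => mu; rewrite mcoeff_msupp mcoeff_component.
by case: asboolP => //; rewrite eqxx.
Qed.

Lemma component_graded b p : gr b p -> component b p = p.
Proof.
move=> /gradedE hp; apply/mpolyP => mu; rewrite mcoeff_component.
by case: asboolP => // H; rewrite memN_msupp_eq0 //; apply/negP => /hp.
Qed.

Lemma function_fieldD x y : ff x -> ff y -> ff (x + y).
Proof.
move=> [b [p [q [hp hq q0 ->]]]] [c [r [t [hr ht t0 ->]]]].
exists (b + c), (p * t + r * q), (q * t); split; last 2 first.
- by rewrite mulf_neq0.
- by rewrite addf_div ?tofrac_eq0 // tofracD !tofracM.
- by apply: gradedD; [|rewrite addrC]; apply: gradedM.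
- exact: gradedM.
Qed.

Lemma function_fieldM x y : ff x -> ff y -> ff (x * y).
Proof.
move=> [b [p [q [hp hq q0 ->]]]] [c [r [t [hr ht t0 ->]]]].
exists (b + c), (p * r), (q * t); split; [exact: gradedM|exact: gradedM| |].
- by rewrite mulf_neq0.
- by rewrite mulf_div !tofracM.
Qed.

Lemma function_fieldC (c : C) : ff (c%:MP : S)%:F.
Proof.
by exists 0, c%:MP, 1%:MP; rewrite mpolyC1 tofrac1 divr1 oner_neq0; split => //; apply: gradedC.
Qed.

Lemma function_field0 : ff 0.
Proof. by have := function_fieldC 0; rewrite mpolyC0 tofrac0. Qed.

Lemma function_field1 : ff 1.
Proof. by have := function_fieldC 1; rewrite mpolyC1 tofrac1. Qed.

Lemma function_fieldV x : ff x -> ff x^-1.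
Proof.
move=> [b [p [q [hp hq q0 ->]]]]; have [->|p0] := eqVneq p 0.
  by rewrite tofrac0 mul0r invr0; apply: function_field0.
by exists b, q, p; rewrite invf_div.
Qed.

Lemma function_field_sum (I : Type) (r : seq I) (P : pred I) (f : I -> K) :
  (forall i, P i -> ff (f i)) -> ff (\sum_(i <- r | P i) f i).
Proof. by move=> H; elim/big_ind: _ => //; [exact: function_field0|exact: function_fieldD]. Qed.

Lemma function_field_prod (I : Type) (r : seq I) (P : pred I) (f : I -> K) :
  (forall i, P i -> ff (f i)) -> ff (\prod_(i <- r | P i) f i).
Proof. by move=> H; elim/big_ind: _ => //; [exact: function_field1|exact: function_fieldM]. Qed.

Lemma function_fieldN x : ff x -> ff (- x).
Proof.
by move=> fx; rewrite -mulN1r -tofrac1 -mpolyC1 -tofracN -mpolyCN;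
  apply: function_fieldM fx; apply: function_fieldC.
Qed.

Lemma function_field_det k (M : 'M[K]_k) : (forall i j, ff (M i j)) -> ff (\det M).
Proof.
move=> H; apply: function_field_sum => s _; apply: function_fieldM;
  last exact: function_field_prod.
by rewrite -signr_odd; case: (odd _); rewrite ?expr0 ?expr1; [apply: function_fieldN|];
  apply: function_field1.
Qed.

Lemma function_field_nat k : ff k%:R.
Proof. by rewrite -tofrac1 -tofracMn -mpolyC1 -mpolyCMn; apply: function_fieldC. Qed.

Lemma function_field_int (k : int) : ff k%:~R.
Proof. by case: k => k; rewrite ?NegzE ?mulrNz; [|apply: function_fieldN];
  apply: function_field_nat. Qed.

(* Some homogeneous component of the denominator q does not vanish at z. *)
Lemma homogeneous_denominator z p q r s b : gr b r -> gr b s -> s != 0 ->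
  q.@[z] != 0 -> p * s = r * q ->
  exists p' q' c, [/\ gr c p', gr c q', q'.@[z] != 0 & p' * s = r * q'].
Proof.
move=> hr hs s0; move: {2}_.+1 (ltnSn (size (msupp q))) => k.
elim: k p q => // k IH p q; rewrite ltnS => sz qz e0.
have [mu muq] : exists mu, mu \in msupp q.
  case E: (msupp q) => [|mu l]; last by exists mu; rewrite mem_head.
  by move/eqP: E; rewrite msupp_eq0 => /eqP q0; rewrite q0 meval0 eqxx in qz.
pose q1 := component (exponents mu) q; pose p1 := component (exponents mu) p.
have e1 : p1 * s = r * q1.
  by rewrite -(componentM _ _ hs) e0 [r * q]mulrC (componentM _ _ hr) mulrC.
have [q1z|q1z] := boolP (q1.@[z] != 0).
  by exists p1, q1, (exponents mu); split=> //; apply: graded_component.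
(* Subtracting a component that vanishes at z keeps the value of q there and removes at least the
   monomial mu. *)
apply: (IH (p - p1) (q - q1)).
- have sub : {subset msupp (q - q1) <= rem mu (msupp q)}.
    move=> nu; rewrite rem_filter ?msupp_uniq // mem_filter /= !mcoeff_msupp mcoeffB.
    rewrite mcoeff_component; case: asboolP => H; first by rewrite subrr eqxx.
    rewrite subr0 => ->; rewrite andbT; apply: contra_notN H => /eqP ->.
    by exists 0; rewrite subrr alpha0.
  have := uniq_leq_size (msupp_uniq _) sub; rewrite size_rem //.
  move/leq_ltn_trans; apply; rewrite prednK //.
  by case: (msupp q) muq.
- by move: q1z; rewrite negbK mevalB => /eqP ->; rewrite subr0.
- by rewrite mulrBl mulrBr e0 e1.
Qed.

(** From right to left, an arbitrary denominator is traded for a homogeneous one. Degree 0 and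
    regularity on affine space can then be checked separately. *)
Lemma local_ringE z x : local_ring e z x <-> ff x /\ regular (eval_at z) x.
Proof.
split=> [[b [p [q [hp hq qz ex]]]]|[[b [r [s [hr hs s0 ex]]]] [p [q [qz ex']]]]].
  split; last by exists p, q.
  by exists b, p, q; split=> //; apply: ev_neq0 qz.
have q0 : q != 0 := ev_neq0 qz.
have [p' [q' [c [hp' hq' q'z e']]]] := homogeneous_denominator hr hs s0 qz
  (proj1 (eq_fracP _ _ q0 s0) (etrans (esym ex') ex)).
by exists c, p', q'; split=> //; rewrite ex;
  apply/esym/(eq_fracP _ _ (ev_neq0 (ev := eval_at z) q'z) s0).
Qed.

Lemma max_idealE z x : max_ideal e z x <-> ff x /\ vanishing (eval_at z) x.
Proof.
split=> [[b [p [q [hp hq pz qz ex]]]]|[fx vx]].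
  split; last by exists p, q.
  by exists b, p, q; split=> //; apply: (ev_neq0 (ev := eval_at z)) qz.
have [b [p [q [hp hq qz ex]]]] := proj2 (local_ringE z x) (conj fx (vanishing_regular vx)).
by exists b, p, q; split=> //; rewrite ex in vx; apply: vanishing_num qz vx.
Qed.

Section LaurentMonomials.
Implicit Types a b : 'rV[int]_n.

Definition pos_part a : 'X_{1..n} := [multinom (if a 0%R i is Posz k then k else 0%N) | i < n].

Lemma pos_partB a : exponents (pos_part a) - exponents (pos_part (- a)) = a.
Proof.
apply/rowP => i; rewrite !mxE !mnmE !mxE.
by case: (a 0 i) => [[|k]|k] //=; rewrite ?subr0 ?sub0r ?NegzE // opprK.
Qed.

Lemma exponents_inj : injective exponents.
Proof. by move=> mu nu /rowP H; apply/mnmP => i; have := H i; rewrite !mxE => -[]. Qed.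

(** For [a = alpha e m] this is the pullback of the character t^m. *)
Definition laurent a : K := 'X_[pos_part a]%:F / 'X_[pos_part (- a)]%:F.

Lemma mpolyX_neq0 mu : 'X_[mu] != 0 :> S.
Proof. by apply/eqP => /mpolyP/(_ mu)/eqP; rewrite mcoeffX eqxx mcoeff0 oner_eq0. Qed.

Lemma laurent_frac mu nu : ('X_[mu] : S)%:F / ('X_[nu] : S)%:F =
  laurent (exponents mu - exponents nu).
Proof.
apply/eq_fracP; rewrite ?mpolyX_neq0 // -!mpolyXD; congr 'X_[_].
apply: exponents_inj; rewrite !exponentsD; set a := _ - _.
have {1}-> : exponents mu = a + exponents nu by rewrite subrK.
by rewrite -{1}(pos_partB a); apply/rowP => i; rewrite !mxE; ring.
Qed.

Lemma laurentD a b : laurent (a + b) = laurent a * laurent b.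
Proof.
rewrite [X in _ = X * _]/laurent [X in _ = _ * X]/laurent mulf_div -!tofracM -!mpolyXD
  laurent_frac.
by rewrite !exponentsD opprD addrACA !pos_partB.
Qed.

Lemma laurent0 : laurent 0 = 1.
Proof. by rewrite /laurent oppr0 divff // tofrac_eq0 mpolyX_neq0. Qed.

Lemma laurent_neq0 a : laurent a != 0.
Proof. by rewrite mulf_neq0 ?invr_eq0 ?tofrac_eq0 ?mpolyX_neq0. Qed.

Lemma laurentN a : laurent (- a) = (laurent a)^-1.
Proof. by apply: (mulfI (laurent_neq0 a));
  rewrite -laurentD subrr laurent0 divff ?laurent_neq0. Qed.

Lemma laurent_mono mu : laurent (exponents mu) = 'X_[mu]%:F.
Proof.
have := laurent_frac mu 0%MM; rewrite mpolyX0 tofrac1 divr1 => ->; congr laurent.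
by apply/rowP => i; rewrite !mxE mnm0E subr0.
Qed.

Lemma regular_laurent z a : (forall i, z i = 0 -> 0 <= a 0 i) -> regular (eval_at z) (laurent a).
Proof.
move=> H; exists 'X_[pos_part a], 'X_[pos_part (- a)]; split=> //; rewrite /= mevalX.
apply/prodf_neq0 => i _; have [zi|zi] := eqVneq (z i) 0; last by rewrite expf_neq0.
rewrite mnmE mxE; have := H i zi; case: (a 0 i) => [[|k]|k] //= _; rewrite ?expr0 ?oner_neq0 //.
Qed.

Lemma function_field_laurent m : ff (laurent (alpha e m)).
Proof.
exists (exponents (pos_part (- alpha e m))), 'X_[pos_part (alpha e m)],
  'X_[pos_part (- alpha e m)].
rewrite mpolyX_neq0; split=> //; last exact: graded_mono.
by apply: gradedX; exists m; rewrite pos_partB.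
Qed.

Lemma prodXE : (\prod_(i < n) 'X_i : S)%:F = laurent (const_mx 1).
Proof.
have -> : const_mx 1 = exponents [multinom 1%N | i < n].
  by apply/rowP => i; rewrite !mxE mnmE.
by rewrite laurent_mono mpolyXE_id; congr _%:F; apply: eq_bigr => i _; rewrite mnmE expr1.
Qed.

(** Exponents of the same class differ by an element of alpha(M), so a homogeneous polynomial
    divided by a monomial of its class is a combination of characters. *)
Lemma laurent_expansion b p nu : gr b p -> in_class b nu ->
  (forall mu, mu \in msupp p -> exists m, alpha e m = exponents mu - exponents nu) /\
  p%:F / 'X_[nu]%:F = \sum_(mu <- msupp p) (p@_mu)%:MP%:F * laurent (exponents mu - exponents nu).
Proof.
move=> /gradedE hp [m0 em0]; split.
  move=> mu /hp [m em]; exists (m - m0); rewrite alphaD alphaN -em -em0.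
  by apply/rowP => i; rewrite !mxE; ring.
rewrite [in LHS](mpolyE p) raddf_sum mulr_suml; apply: eq_bigr => mu _ /=.
by rewrite -mul_mpolyC tofracM -mulrA laurent_frac.
Qed.

End LaurentMonomials.

End Graded.

(** * Rational forms of top degree *)

Section Euler.
Context (R : realType) (n : nat).
Local Notation C := R[i].
Local Notation S := {mpoly C[n]}.
Local Notation K := {fraction S}.
Implicit Types (p q : S) (x y : K) (i : 'I_n).

Lemma pderivD i x y : pderiv i (x + y) = pderiv i x + pderiv i y.
Proof. exact: (frac_derivD (mderivD i) (mderivM i)). Qed.

Lemma pderivM i x y : pderiv i (x * y) = pderiv i x * y + x * pderiv i y.
Proof. exact: (frac_derivM (mderivM i)). Qed.

Lemma pderivV i x : pderiv i x^-1 = - pderiv i x / x ^+ 2.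
Proof. exact: (frac_derivV (mderivD i) (mderivM i)). Qed.

Lemma pderiv_tofrac i p : pderiv i p%:F = (p^`M(i))%:F.
Proof. exact: (frac_deriv_tofrac (mderivM i)). Qed.

Lemma regular_pderiv z i x : regular (eval_at z) x -> regular (eval_at z) (pderiv i x).
Proof. exact: (regular_frac_deriv (mderivD i) (mderivM i)). Qed.

(** The torus invariant vector field z_i d/dz_i: it preserves degrees and is diagonal on Laurent
    monomials, with the exponents as eigenvalues. *)
Definition euler i x : K := ('X_i : S)%:F * pderiv i x.

Lemma eulerD i x y : euler i (x + y) = euler i x + euler i y.
Proof. by rewrite /euler pderivD mulrDr. Qed.

Lemma eulerM i x y : euler i (x * y) = euler i x * y + x * euler i y.
Proof.
rewrite /euler pderivM; move: (pderiv i x) (pderiv i y) ('X_i)%:F => a b c.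
by rewrite mulrDr mulrA (mulrCA c).
Qed.

Lemma eulerV i x : euler i x^-1 = - euler i x / x ^+ 2.
Proof.
rewrite /euler pderivV; move: (pderiv i x) ('X_i)%:F => a c.
by rewrite mulrA mulrN.
Qed.

Lemma eulerC i (c : C) : euler i (c%:MP : S)%:F = 0.
Proof. by rewrite /euler pderiv_tofrac mderivC tofrac0 mulr0. Qed.

Lemma euler_mono i (mu : 'X_{1..n}) : euler i ('X_[mu] : S)%:F = (mu i)%:R * 'X_[mu]%:F.
Proof.
rewrite /euler pderiv_tofrac -tofracM mderivX -scalerAr -mpolyXD.
have [->|mi] := posnP (mu i); first by rewrite scale0r tofrac0 mul0r.
rewrite addmC submK; last by apply/mnm_lepP => j; rewrite mnm1E; case: eqP => // <-.
by rewrite -mul_mpolyC tofracM mpolyCMn mpolyC1 tofracMn tofrac1.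
Qed.

Lemma frac_dlog (F : fieldType) (L x y a b dL : F) : y != 0 ->
  L = x / y -> dL * y + L * (b * y) = a * x -> dL = (a - b) * L.
Proof.
move=> y0 -> e; apply: (mulIf y0).
have -> : dL * y = a * x - x / y * (b * y) by rewrite -e; ring.
by field.
Qed.

Lemma euler_laurent i (a : 'rV[int]_n) : euler i (laurent R a) = (a 0 i)%:~R * laurent R a.
Proof.
have ny : ('X_[pos_part (- a)] : S)%:F != 0 by rewrite tofrac_eq0 mpolyX_neq0.
have eL : laurent R a = ('X_[pos_part a] : S)%:F / ('X_[pos_part (- a)] : S)%:F by [].
rewrite (frac_dlog ny eL (dL := euler i (laurent R a)) (a := (pos_part a i)%:R)
  (b := (pos_part (- a) i)%:R)).
  have /rowP/(_ i) := pos_partB a; rewrite !mxE => ea.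
  by rewrite -[in (a 0 i)%:~R]ea rmorphB.
by rewrite -!euler_mono -eulerM eL divfK.
Qed.

End Euler.

Section Forms.
Context (R : realType) (d n : nat) (e : 'I_n -> 'rV[int]_d) (B : 'M[int]_d).
Hypothesis uB : B \in unitmx.
Local Notation C := R[i].
Local Notation S := {mpoly C[n]}.
Local Notation K := {fraction S}.
Local Notation gr := (graded_part (R := R) e).
Local Notation ff := (function_field (R := R) e).
Local Notation PX := ((\prod_(i < n) 'X_i : S)%:F).
Local Notation Om := (Omega0 R e B).
Implicit Types (p q : S) (x y : K) (m : 'rV[int]_d) (z : 'I_n -> C).

Lemma pairing_coord m v :
  pairing m v = \sum_l (m *m invmx B) 0 l * pairing (row l B) v.
Proof.
rewrite -{1}[m](mulmxKV uB) pairingE -[_ *m B *m _]mulmxA mxE.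
by apply: eq_bigr => l _; rewrite pairing_row.
Qed.

(* The vectors (<m_l, e_i>)_i span the space of the vectors (z_i dx/dz_i)_i,
   x running through the function field: they come from the characters t^(m_l). *)
Definition euler_coord (x : K) (c : 'I_d -> K) :=
  forall i, euler i x = \sum_l c l * (pairing (row l B) (e i))%:~R.

Lemma euler_coord_character m : euler_coord (laurent R (alpha e m))
  (fun l => laurent R (alpha e m) * ((m *m invmx B) 0 l)%:~R).
Proof.
move=> i; rewrite euler_laurent mxE pairing_coord rmorph_sum mulr_suml.
by apply: eq_bigr => l _; rewrite rmorphM /= mulrC mulrA.
Qed.

(** The elements with such coordinates are closed under field operations and include the constants
    and the characters. These generate the function field: dividing p and q by one monomial of q
    turns both into combinations of characters. *)
Lemma euler_coord_function_field x : ff x -> exists c, (forall l, ff (c l)) /\ euler_coord x c.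
Proof.
pose good x := exists c, (forall l, ff (c l)) /\ euler_coord x c.
have goodD y y' : good y -> good y' -> good (y + y').
  move=> [c [fc hc]] [c' [fc' hc']]; exists (fun l => c l + c' l); split.
    by move=> l; apply: function_fieldD.
  move=> i; rewrite eulerD hc hc' -big_split; apply: eq_bigr => l _ /=.
  by rewrite mulrDl.
have good0 : good 0.
  exists (fun=> 0); split=> [l|i]; first exact: function_field0.
  by rewrite -tofrac0 -mpolyC0 eulerC big1 // => l _; rewrite mul0r.
have goodM y y' : ff y -> ff y' -> good y -> good y' -> good (y * y').
  move=> fy fy' [c [fc hc]] [c' [fc' hc']].
  exists (fun l => c l * y' + y * c' l); split.
    by move=> l; apply: function_fieldD; apply: function_fieldM.
  move=> i; rewrite eulerM hc hc' mulr_suml mulr_sumr -big_split.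
  by apply: eq_bigr => l _ /=; rewrite mulrDl mulrAC mulrA.
have goodV y : ff y -> good y -> good y^-1.
  move=> fy [c [fc hc]]; exists (fun l => - (c l / y ^+ 2)); split.
    by move=> l; apply: function_fieldN; apply: function_fieldM => //;
      apply: function_fieldV; apply: function_fieldM.
  move=> i; rewrite eulerV hc mulNr mulr_suml -sumrN.
  by apply: eq_bigr => l _; rewrite mulNr mulrAC.
have goodC (a : C) : good (a%:MP : S)%:F.
  exists (fun=> 0); split=> [l|i]; first exact: function_field0.
  by rewrite eulerC big1 // => l _; rewrite mul0r.
have goodL m : good (laurent R (alpha e m)).
  exists (fun l => laurent R (alpha e m) * ((m *m invmx B) 0 l)%:~R); split.
    by move=> l; apply: function_fieldM;
      [exact: function_field_laurent|exact: function_field_int].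
  exact: euler_coord_character.
have main b p nu : gr b p -> in_class e b nu ->
    ff (p%:F / ('X_[nu] : S)%:F) /\ good (p%:F / ('X_[nu] : S)%:F).
  move=> gp hnu; have [hm ->] := laurent_expansion gp hnu.
  rewrite big_seq; elim/big_ind: _ => [|y y' [? ?] [? ?]|mu /hm [m <-]].
  - by split=> //; apply: function_field0.
  - by split; [apply: function_fieldD|apply: goodD].
  - have [fc fl] := (function_fieldC (d := d) e p@_mu, function_field_laurent R e m).
    by split; [apply: function_fieldM|apply: goodM].
move=> [b [p [q [gp gq q0 ->]]]].
have [nu nuq] : exists nu, nu \in msupp q.
  case E: (msupp q) => [|mu l]; last by exists mu; rewrite mem_head.
  by move/eqP: E; rewrite msupp_eq0 (negPf q0).
have hnu : in_class e b nu by apply: gq.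
have [[fp gdp] [fq gdq]] := (main b p nu gp hnu, main b q nu gq hnu).
have -> : p%:F / q%:F = p%:F / ('X_[nu] : S)%:F / (q%:F / ('X_[nu] : S)%:F).
  by rewrite invf_div mulrA divfK // tofrac_eq0 mpolyX_neq0.
exact: (goodM _ _ fp (function_fieldV fq) gdp (goodV _ fq gdq)).
Qed.

Lemma PX_neq0 : PX != 0.
Proof. by rewrite prodXE laurent_neq0. Qed.

Lemma prod_idx (I : dsubset d n) :
  \prod_(k < d) ('X_(idx I k) : S)%:F = (\prod_(i in val I) 'X_i : S)%:F.
Proof.
rewrite rmorph_prod -[RHS]big_enum -[LHS]big_enum /=.
rewrite -(big_map (idx I) xpredT (fun i => ('X_i : S)%:F)); apply: perm_big.
apply: uniq_perm => [||i]; rewrite ?enum_uniq //.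
  by rewrite map_inj_uniq ?enum_uniq //; apply: idx_inj.
by rewrite mem_idx mem_enum.
Qed.

Lemma wedge_euler (h : 'I_d -> K) (c : 'I_d -> 'I_d -> K) :
  (forall j, euler_coord (h j) (c j)) ->
  wedge_d h = (\det (\matrix_(j, l) c j l) / PX) *: Om.
Proof.
move=> hc; apply/ffunP => I; rewrite !ffunE /GRing.scale /=.
set M := \matrix_(_, _) _.
(* A partial derivative is z_i^-1 times the Euler derivative, so the Jacobian minor on I is the
   product of the coordinates c, the pairings and the diagonal of the z_i^-1. *)
have -> : M = (\matrix_(j, l) c j l) *m
    map_mx (intr : int -> K) (\matrix_(j < d, k < d) pairing (row j B) (e (idx I k))) *m
    diag_mx (\row_k (('X_(idx I k) : S)%:F)^-1).
  apply/matrixP => j k; rewrite mul_mx_diag !mxE.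
  apply/(canRL (mulfK _)); first by rewrite tofrac_eq0 mpolyX_neq0.
  rewrite mulrC -[LHS]/(euler _ _) hc; apply: eq_bigr => l _.
  by rewrite !mxE.
rewrite !det_mulmx det_diag det_map_mx.
have -> : \prod_k (\row_k (('X_(idx I k) : S)%:F)^-1) 0 k =
    ((\prod_(i in val I) 'X_i : S)%:F)^-1.
  by rewrite -prod_idx -prodfV; apply: eq_bigr => k _; rewrite mxE.
set D := \det _; set E := (\det _)%:~R.
have -> : (\prod_(i < n) 'X_i : S) = (\prod_(i in val I) 'X_i) * (\prod_(i in ~: val I) 'X_i).
  by rewrite (bigID (mem (val I))) /=; congr (_ * _); apply: eq_bigl => i; rewrite inE.
rewrite tofracM [in RHS]mulrA -[in RHS](mulrAC D E) -!mulrA; congr (_ * (_ * _)).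
rewrite invfM -mulrA mulVf ?mulr1 // tofrac_eq0.
by apply/prodf_neq0 => i _; apply: mpolyX_neq0.
Qed.

Lemma wedge_characters (M : 'M[int]_d) :
  wedge_d (fun j => laurent R (alpha e (row j M))) =
  ((\prod_j laurent R (alpha e (row j M))) * (\det (M *m invmx B))%:~R / PX) *: Om.
Proof.
rewrite (wedge_euler (fun j => euler_coord_character (row j M))); congr ((_ / _) *: _).
have -> : \matrix_(j, l) (laurent R (alpha e (row j M)) * ((row j M *m invmx B) 0 l)%:~R)
   = diag_mx (\row_j laurent R (alpha e (row j M))) *m map_mx (intr : int -> K) (M *m invmx B).
  by apply/matrixP => j l; rewrite mul_diag_mx [LHS]mxE -row_mul [(row j _) _ _]mxE !mxE.
rewrite det_mulmx det_diag det_map_mx; congr (_ * _).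
by apply: eq_bigr => j _; rewrite mxE.
Qed.

Lemma forms_overZ (A : set K) : (forall x y, A x -> A y -> A (x * y)) ->
  forall a (w : dform R d n), A a -> forms_over A w -> forms_over A (a *: w).
Proof.
move=> AM a w Aa [r [g [h [Ag Ah ->]]]]; exists r, (fun l => a * g l), h; split=> //.
  by move=> l; apply: AM.
by rewrite scaler_sumr; apply: eq_bigr => l _; rewrite scalerA.
Qed.

Lemma forms_over1 (A : set K) g (h : 'I_d -> K) : A g -> (forall j, A (h j)) ->
  forms_over A (g *: wedge_d h : dform R d n).
Proof.
by move=> Ag Ah; exists 1%N, (fun=> g), (fun=> h); split=> //; rewrite big_ord1.
Qed.

Lemma rational_dformP (w : dform R d n) :
  rational_dform e w <-> exists2 x, ff x & w = (x / PX) *: Om.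
Proof.
split=> [[r [g [h [fg fh ->]]]]|[x fx ->]].
  have H l j := euler_coord_function_field (fh l j).
  pose c l j := projT1 (cid (H l j)).
  have cP l j : (forall k, ff (c l j k)) /\ euler_coord (h l j) (c l j) by rewrite /c; case: cid.
  exists (\sum_l g l * \det (\matrix_(j, k) c l j k)).
    by apply: function_field_sum => l _; apply: function_fieldM => //;
      apply: function_field_det => j k; rewrite mxE; apply: (cP l j).1.
  rewrite mulr_suml scaler_suml; apply: eq_bigr => l _.
  by rewrite (wedge_euler (fun j => (cP l j).2)) scalerA mulrA.
(* For the rows of B the change of basis has determinant 1, so a single wedge of characters already
   gives [Omega0] up to a known Laurent monomial. *)
pose L := \prod_j laurent R (alpha e (row j B)).
have L0 : L != 0 by apply/prodf_neq0 => j _; apply: laurent_neq0.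
have -> : (x / PX) *: Om = (x / L) *: wedge_d (fun j => laurent R (alpha e (row j B))).
  rewrite wedge_characters (mulmxV uB) det1 mulr1 scalerA -/L; congr (_ *: _).
  by rewrite mulrA divfK.
apply: forms_over1; last by move=> j; apply: function_field_laurent.
by apply: function_fieldM => //; apply: function_fieldV; apply: function_field_prod => j _;
  apply: function_field_laurent.
Qed.

End Forms.

(** * Smooth points *)

Section Vanishing.
Context (A : idomainType) (F : fieldType) (f : {rmorphism A -> F}).
Implicit Types x y : {fraction A}.

Lemma vanishing0 : vanishing f 0.
Proof. by exists 0, 1; rewrite rmorph0 rmorph1 oner_neq0 tofrac0 mul0r. Qed.

Lemma vanishingD x y : vanishing f x -> vanishing f y -> vanishing f (x + y).
Proof.
move=> [p [q [p0 q0 ->]]] [r [s [r0 s0 ->]]]; exists (p * s + r * q), (q * s).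
rewrite rmorphD !rmorphM p0 r0 !mul0r addr0 mulf_neq0 //; split=> //.
by rewrite addf_div ?tofrac_eq0 ?(ev_neq0 (ev := f)) // tofracD !tofracM.
Qed.

Lemma vanishingM x y : regular f x -> vanishing f y -> vanishing f (x * y).
Proof.
move=> [p [q [q0 ->]]] [r [s [r0 s0 ->]]]; exists (p * r), (q * s).
by rewrite !rmorphM r0 mulr0 mulf_neq0 // mulf_div ?tofracM.
Qed.

Lemma vanishing_tofrac p : vanishing f p%:F -> f p = 0.
Proof.
move=> H; apply: (vanishing_num (q := 1)); first by rewrite rmorph1 oner_neq0.
by rewrite tofrac1 divr1.
Qed.

End Vanishing.

(** * A sufficient condition for smoothness *)

Section LocalRing.
Context (R : realType) (d n : nat) (e : 'I_n -> 'rV[int]_d) (z : 'I_n -> R[i]).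
Local Notation C := R[i].
Local Notation S := {mpoly C[n]}.
Local Notation K := {fraction S}.
Local Notation ff := (function_field (R := R) e).
Local Notation OZ := (local_ring e z).
Local Notation T m := (laurent R (alpha e m)).
Local Notation cst c := ((c%:MP : S)%:F).
Implicit Types (x y : K) (m : 'rV[int]_d) (c : C).

Lemma local_ringD x y : OZ x -> OZ y -> OZ (x + y).
Proof.
by move=> /local_ringE[? ?] /local_ringE[? ?]; apply/local_ringE; split;
  [apply: function_fieldD|apply: regularD].
Qed.

Lemma local_ringM x y : OZ x -> OZ y -> OZ (x * y).
Proof.
by move=> /local_ringE[? ?] /local_ringE[? ?]; apply/local_ringE; split;
  [apply: function_fieldM|apply: regularM].
Qed.

Lemma local_ringC c : OZ (cst c).
Proof. by apply/local_ringE; split; [exact: function_fieldC|exact: regular_tofrac]. Qed.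

(** The monoid of the characters regular at [z]: the lattice points of the dual of the cone spanned
    by the e_i with z_i = 0. *)
Definition nonneg m := forall i, z i = 0 -> 0 <= pairing m (e i).

Lemma local_ringT m : nonneg m -> OZ (T m).
Proof.
move=> H; apply/local_ringE; split; first exact: function_field_laurent.
by apply: regular_laurent => i zi; rewrite mxE; apply: H.
Qed.

Lemma cstD c c' : cst (c + c') = cst c + cst c'.
Proof. by rewrite mpolyCD tofracD. Qed.

Lemma cstM c c' : cst (c * c') = cst c * cst c'.
Proof. by rewrite mpolyCM tofracM. Qed.

Lemma regular_value x : regular (eval_at z) x -> exists c, vanishing (eval_at z) (x - cst c).
Proof.
move=> [p [q [qz ->]]]; exists (p.@[z] / q.@[z]).
exists (p - (p.@[z] / q.@[z])%:MP * q), q; split=> //.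
  by rewrite /= mevalB mevalM mevalC divfK // subrr.
by rewrite tofracB tofracM mulrBl mulfK // tofrac_eq0; apply: ev_neq0 qz.
Qed.

Lemma characterD m m' : T (m + m') = T m * T m'.
Proof. by rewrite alphaD laurentD. Qed.

Lemma character0 : T 0 = 1.
Proof. by rewrite alpha0 laurent0. Qed.

Section Generators.
Variable B : 'M[int]_d.
Hypotheses (uB : B \in unitmx) (B_nonneg : forall j, nonneg (row j B))
  (B_coord : forall m, nonneg m -> forall j,
     0 <= (m *m invmx B) 0 j \/ nonneg (- row j B)).

(** The hypotheses make [nonneg] the product of a free monoid and a free group on the rows of B. The
    maximal ideal is generated by the characters of these rows minus their values at z: modulo
    these, every regular character is a constant. *)
Lemma smooth_of_monoid_basis : smooth_point e z.
Proof.
have cP j : exists c, vanishing (eval_at z) (T (row j B) - cst c).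
  by apply: regular_value; have /local_ringE[] := local_ringT (B_nonneg j).
pose c0 j := projT1 (cid (cP j)); pose t j := T (row j B) - cst (c0 j).
have vt j : vanishing (eval_at z) (t j) by rewrite /t /c0; case: cid.
have lt j : OZ (t j).
  rewrite /t -tofracN -mpolyCN; apply: local_ringD; last exact: local_ringC.
  exact/local_ringT/B_nonneg.
exists t; first by move=> j; apply/max_idealE; split=> //; have /local_ringE[] := lt j.
pose I x := exists2 c : 'I_d -> K, forall j, OZ (c j) & x = \sum_j c j * t j.
have I0 : I 0.
  exists (fun=> cst 0); first by move=> j; apply: local_ringC.
  by rewrite big1 // => j _; rewrite mpolyC0 tofrac0 mul0r.
have ID x y : I x -> I y -> I (x + y).
  move=> [c hc ->] [c' hc' ->]; exists (fun j => c j + c' j).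
    by move=> j; apply: local_ringD.
  by rewrite -big_split; apply: eq_bigr => j _; rewrite mulrDl.
have IM a x : OZ a -> I x -> I (a * x).
  move=> ha [c hc ->]; exists (fun j => a * c j); first by move=> j; apply: local_ringM.
  by rewrite mulr_sumr; apply: eq_bigr => j _; rewrite mulrA.
have It j : I (t j).
  exists (fun k => cst (k == j)%:R); first by move=> k; apply: local_ringC.
  rewrite (bigD1 j) //= eqxx mpolyC1 tofrac1 mul1r big1 ?addr0 // => k /negPf ->.
  by rewrite mpolyC0 tofrac0 mul0r.
have Iv x : I x -> vanishing (eval_at z) x.
  move=> [c hc ->]; elim/big_ind: _ => [||j _]; [exact: vanishing0|exact: vanishingD|].
  by apply: vanishingM => //; have /local_ringE[] := hc j.
pose P m := OZ (T m) /\ exists c, I (T m - cst c).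
have P0 : P 0.
  rewrite /P character0; split; first by have := local_ringC 1; rewrite mpolyC1 tofrac1.
  by exists 1; rewrite mpolyC1 tofrac1 subrr.
have PD m m' : P m -> P m' -> P (m + m').
  move=> [lm [c Ic]] [lm' [c' Ic']]; rewrite /P characterD; split; first exact: local_ringM.
  exists (c * c'); rewrite cstM.
  have -> : T m * T m' - cst c * cst c' = T m' * (T m - cst c) + cst c * (T m' - cst c').
    by move: (T m) (T m') (cst c) (cst c') => *; ring.
  by apply: ID; apply: IM => //; apply: local_ringC.
have PB j : P (row j B).
  by split; [exact/local_ringT/B_nonneg|exists (c0 j); apply: It].
have PN j : nonneg (- row j B) -> P (- row j B).
  move=> nn; have lN := local_ringT nn; split => //.
  have TN : T (- row j B) * T (row j B) = 1 by rewrite -characterD addNr character0.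
  have c00 : c0 j != 0.
    apply/eqP => cj; have /local_ringE[_ rN] := lN.
    have := vanishingM rN (vt j); rewrite /t cj mpolyC0 tofrac0 subr0 TN -tofrac1.
    by move/vanishing_tofrac; rewrite rmorph1 => /eqP; rewrite oner_eq0.
  exists (c0 j)^-1.
  have -> : T (- row j B) - cst (c0 j)^-1 = (cst (- (c0 j)^-1) * T (- row j B)) * t j.
    rewrite /t; have e1 : cst (c0 j)^-1 * cst (c0 j) = 1 by rewrite -cstM mulVf // mpolyC1
      tofrac1.
    rewrite mpolyCN tofracN.
    move: (cst _^-1) (cst (c0 j)) (T (row j B)) (T (- row j B)) TN e1 => a b x y yx ab.
    by rewrite mulrBr -[_ * y * x]mulrA yx mulr1 !mulNr mulrAC ab mul1r opprK addrC.
  by apply: IM => //; apply: local_ringM => //; apply: local_ringC.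
have PMn m k : P m -> P (m *+ k).
  by move=> Pm; elim: k => [|k IH]; rewrite ?mulr0n // mulrSr; apply: PD.
have Pnn m : nonneg m -> P m.
  move=> nm; rewrite -[m](mulmxKV uB) mulmx_sum_row; elim/big_ind: _ => // j _.
  have := B_coord nm j; case: (_ 0 j) => k; first by rewrite -natz scaler_nat => _; apply: PMn.
  by case=> // nn; rewrite NegzE scaleNr -scalerN -natz scaler_nat; apply/PMn/PN.
move=> x [b [p [q [gp gq pz qz ->]]]].
(* A monomial of q that does not vanish at z has exponent 0 on the vanishing coordinates; dividing p
   by it only produces characters regular at [z]. *)
have [nu [nuq nuz]] : exists nu, nu \in msupp q /\ ('X_[nu] : S).@[z] != 0.
  apply/not_existsP => H; case/eqP: qz; rewrite [q]mpolyE raddf_sum big_seq big1 // => mu muq.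
  have /not_andP[|] := H mu; first by rewrite muq.
  by move/negP; rewrite negbK /= mevalZ => /eqP ->; rewrite mulr0.
have nu0 i : z i = 0 -> nu i = 0%N.
  move=> zi; apply/eqP; move: nuz; rewrite mevalX => /prodf_neq0/(_ i isT).
  by rewrite zi; case: (nu i) => // k; rewrite exprS mul0r eqxx.
have hnu : in_class e b nu by apply: gq.
have [hm hexp] := laurent_expansion gp hnu.
set y := p%:F / 'X_[nu]%:F in hexp.
have vy : vanishing (eval_at z) y by exists p, 'X_[nu].
have [c Ic] : exists c, I (y - cst c).
  rewrite hexp big_seq; elim/big_ind: _ => [|y1 y2 [c1 I1] [c2 I2]|mu /hm [m em]].
  - by exists 0; rewrite mpolyC0 tofrac0 subrr.
  - by exists (c1 + c2); rewrite cstD opprD addrACA; apply: ID.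
  - have [|_ [c Ic]] := Pnn m.
      move=> i zi; have /rowP/(_ i) := em; rewrite !mxE (nu0 i zi) subr0 => ->.
      by [].
    exists (p@_mu * c); rewrite -em cstM -mulrBr; apply: IM => //; exact: local_ringC.
have cz : c = 0.
  have : vanishing (eval_at z) (cst c).
    have -> : cst c = y + cst (-1) * (y - cst c).
      by rewrite mpolyCN mpolyC1 tofracN tofrac1 mulN1r opprB addrC subrK.
    by apply: vanishingD => //; apply: vanishingM; [exact: regular_tofrac|exact: Iv].
  by move/vanishing_tofrac; rewrite /= mevalC.
move: Ic; rewrite cz mpolyC0 tofrac0 subr0 => Iy.
have -> : p%:F / q%:F = ('X_[nu]%:F / q%:F) * y.
  by rewrite /y [RHS]mulrC [RHS]mulrA divfK // tofrac_eq0 mpolyX_neq0.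
apply: IM => //; exists b, 'X_[nu], q; split=> //.
by apply: gradedX.
Qed.

End Generators.

(** In a basis of M adapted to the primitive vector e_i the monoid is N x Z^(d-1); without a
    vanishing coordinate it is all of M. *)
Lemma smooth_one_zero : (forall i, primitive (e i)) ->
  (forall i j, z i = 0 -> z j = 0 -> i = j) -> smooth_point e z.
Proof.
move=> pe H; have [[i zi]|Hn] := pselect (exists i, z i = 0).
  have [C uC [j0 hC]] := primitive_unimodular (pe i).
  have eqi i' : z i' = 0 -> i' = i by move=> zi'; apply: H.
  apply: (smooth_of_monoid_basis uC) => [j i' /eqi ->|m nm j].
    by rewrite hC ler0n.
  have := nm i zi; rewrite (pairing_coord uC) (bigD1 j0) //= hC eqxx mulr1 big1 ?addr0.
    move=> nn; have [->|jj0] := eqVneq j j0; [by left|right].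
    by move=> i' /eqi ->; rewrite pairingNl hC (negPf jj0) oppr0.
  by move=> l /negPf ll0; rewrite hC ll0 mulr0.
have nz i : z i <> 0 by move=> zi; apply: Hn; exists i.
apply: (smooth_of_monoid_basis (unitmx1 _ _)) => [j i /nz|m _ j] //.
by right=> i /nz.
Qed.

End LocalRing.

(** * Linear functionals on the cotangent space *)

Section WeightFunctional.
Context (n : nat) (F : comNzRingType).
Implicit Types (w : 'X_{1..n} -> F) (p q : {mpoly F[n]}).

Definition weight w p : F := \sum_(mu <- msupp p) p@_mu * w mu.

Lemma weightE w p k : (msize p <= k)%N ->
  weight w p = \sum_(mu : 'X_{1..n < k}) p@_mu * w mu.
Proof.
move=> pk; rewrite /weight (ssrcomplements.big_mksub 'X_{1..n < k}) ?msupp_uniq //=; last first.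
  by move=> mu /msize_mdeg_lt /leq_trans; apply.
by rewrite big_rmcond //= => mu /memN_msupp_eq0 ->; rewrite mul0r.
Qed.

Lemma weightD w p q : weight w (p + q) = weight w p + weight w q.
Proof.
pose k := maxn (msize (p + q)) (maxn (msize p) (msize q)).
rewrite !(@weightE _ _ k) ?leq_max ?leqnn ?orbT //.
by rewrite -big_split; apply: eq_bigr => mu _; rewrite mcoeffD mulrDl.
Qed.

Lemma weightZX w c mu : weight w (c *: 'X_[mu]) = c * w mu.
Proof.
pose k := maxn (msize (c *: 'X_[mu] : {mpoly F[n]})) (mdeg mu).+1.
rewrite (@weightE _ _ k) ?leq_max ?leqnn ?orbT //.
have hk : (mdeg mu < k)%N by rewrite leq_max leqnn orbT.
rewrite (bigD1 (BMultinom hk)) //= mcoeffZ mcoeffX eqxx mulr1 big1 ?addr0 // => nu.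
rewrite -val_eqE /= => /negPf ne.
by rewrite mcoeffZ mcoeffX eq_sym ne mulr0 mul0r.
Qed.

Lemma weight0 w : weight w 0 = 0.
Proof. by rewrite /weight msupp0 big_nil. Qed.

Lemma weight_sum w (I : Type) (r : seq I) (P : pred I) (f : I -> {mpoly F[n]}) :
  weight w (\sum_(i <- r | P i) f i) = \sum_(i <- r | P i) weight w (f i).
Proof. exact: (big_morph _ (weightD w) (weight0 w)). Qed.

(** Bilinearity carries the Leibniz rule from monomials to polynomials. In the application v is
    evaluation at z and Q selects the monomials on which the rule is known. *)
Lemma weightM w v (Q : 'X_{1..n} -> Prop) p q :
  (forall mu nu, Q mu -> Q nu -> w (mu + nu)%MM = w mu * v nu + v mu * w nu) ->
  {in msupp p, forall mu, Q mu} -> {in msupp q, forall mu, Q mu} ->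
  weight w (p * q) = weight w p * weight v q + weight v p * weight w q.
Proof.
move=> wM Qp Qq.
rewrite [in LHS](mpolyE p) [in LHS](mpolyE q) mulr_suml weight_sum.
rewrite -[weight w p]/(\sum_(mu <- msupp p) _) -[weight v p]/(\sum_(mu <- msupp p) _).
rewrite !mulr_suml -big_split big_seq [RHS]big_seq; apply: eq_bigr => mu /Qp hmu.
rewrite [in LHS]mulr_sumr weight_sum !mulr_sumr -big_split big_seq [RHS]big_seq.
apply: eq_bigr => nu /Qq hnu /=.
by rewrite -scalerAl -scalerAr scalerA -mpolyXD weightZX wM //; ring.
Qed.

Lemma meval_weight (z : 'I_n -> F) p : p.@[z] = weight (fun mu => ('X_[mu]).@[z]) p.
Proof.
rewrite {1}[p]mpolyE raddf_sum; apply: eq_bigr => mu _.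
by rewrite /= mevalZ.
Qed.

End WeightFunctional.

Section Cotangent.
Context (R : realType) (d n : nat) (e : 'I_n -> 'rV[int]_d) (z : 'I_n -> R[i]).
Local Notation C := R[i].
Local Notation S := {mpoly C[n]}.
Local Notation K := {fraction S}.
Local Notation gr := (graded_part (R := R) e).
Local Notation ff := (function_field (R := R) e).
Local Notation OZ := (local_ring e z).
Local Notation T m := (laurent R (alpha e m)).
Local Notation cst c := ((c%:MP : S)%:F).
Local Notation zv mu := (('X_[mu] : S).@[z]).
Implicit Types (x y : K) (p q : S) (m : 'rV[int]_d) (c : C) (w : 'X_{1..n} -> C).

Definition invariant_mono (mu : 'X_{1..n}) :=
  exists m, forall i, z i = 0 -> (mu i)%:Z = pairing m (e i).

Definition invariant_poly p := {in msupp p, forall mu, invariant_mono mu}.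

(* The Leibniz rule is only required on monomials whose exponents along the
   vanishing coordinates come from M: these span a ring which contains, up to
   a common factor, the numerators and denominators of the local ring at [z]. *)
Definition point_derivation w := forall mu nu, invariant_mono mu -> invariant_mono nu ->
  w (mu + nu)%MM = w mu * zv nu + zv mu * w nu.

Lemma invariantD p q : invariant_poly p -> invariant_poly q -> invariant_poly (p + q).
Proof. by move=> hp hq mu /msuppD_le; rewrite mem_cat => /orP[/hp|/hq]. Qed.

Lemma invariantM p q : invariant_poly p -> invariant_poly q -> invariant_poly (p * q).
Proof.
move=> hp hq mu /msuppM_le /allpairsP[[m1 m2] /= [h1 h2 ->]].
have [[k1 e1] [k2 e2]] := (hp _ h1, hq _ h2).
by exists (k1 + k2) => i zi; rewrite mnmDE PoszD pairingDl e1 // e2.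
Qed.

Lemma mono_nonzero mu i : zv mu != 0 -> z i = 0 -> mu i = 0%N.
Proof.
move=> muz zi; apply/eqP; move: muz; rewrite mevalX => /prodf_neq0/(_ i isT).
by rewrite zi; case: (mu i) => // k; rewrite exprS mul0r eqxx.
Qed.

Lemma nonvanishing_monomial q : q.@[z] != 0 -> exists2 nu, nu \in msupp q & zv nu != 0.
Proof.
move=> qz; apply: contrapT => H; case/eqP: qz.
rewrite meval_weight /weight big_seq big1 // => mu muq.
have [->|ne] := eqVneq (zv mu) 0; first by rewrite mulr0.
by case: H; exists mu.
Qed.

(** A monomial of q that does not vanish at z has exponent 0 on the vanishing coordinates, so there
    the exponents of p are those of its difference from that monomial, which lies in alpha(M). *)
Lemma graded_invariant b p q : gr b p -> gr b q -> q.@[z] != 0 -> invariant_poly p.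
Proof.
move=> gp gq /nonvanishing_monomial [nu /gq [m0 em0] nuz] mu /gp [m em].
exists (m - m0) => i zi; rewrite pairingDl pairingNl.
move: (congr1 (fun v : 'rV[int]_n => v 0 i) em) (congr1 (fun v : 'rV[int]_n => v 0 i) em0).
by rewrite !mxE (mono_nonzero nuz zi) sub0r => <- <-; rewrite opprK subrK.
Qed.

Lemma weight_invariantM w p q : point_derivation w -> invariant_poly p -> invariant_poly q ->
  weight w (p * q) = weight w p * q.@[z] + p.@[z] * weight w q.
Proof.
move=> dw hp hq; rewrite (weightM (v := fun mu => zv mu) dw hp hq).
by rewrite -!meval_weight.
Qed.

(** The quotient rule for a fraction vanishing at z, where the term with [p.@[z]] drops out. It is a
    relation because the value is read off a representative; [has_derivative_uniq] makes it well
    defined. *)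
Definition has_derivative w x (y : C) := exists p q,
  [/\ invariant_poly p, invariant_poly q, p.@[z] = 0, q.@[z] != 0
    & x = p%:F / q%:F /\ y = weight w p / q.@[z]].

Section Derivative.
Variable w : 'X_{1..n} -> C.
Hypothesis dw : point_derivation w.

Lemma has_derivative_uniq x a b : has_derivative w x a -> has_derivative w x b -> a = b.
Proof.
move=> [p [q [hp hq pz qz [-> ->]]]] [r [s [hr hs rz sz [ex ->]]]].
have := proj1 (eq_fracP _ _ (ev_neq0 (ev := eval_at z) qz) (ev_neq0 (ev := eval_at z) sz)) ex.
move/(congr1 (weight w)); rewrite !weight_invariantM // pz rz !mul0r !addr0 => e1.
by apply/eqP; rewrite eqr_div // e1.
Qed.

Lemma has_derivativeD x y a b : has_derivative w x a -> has_derivative w y b ->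
  has_derivative w (x + y) (a + b).
Proof.
move=> [p [q [hp hq pz qz [-> ->]]]] [r [s [hr hs rz sz [-> ->]]]].
exists (p * s + r * q), (q * s); split.
- by apply: invariantD; apply: invariantM.
- exact: invariantM.
- by rewrite mevalD !mevalM pz rz !mul0r addr0.
- by rewrite mevalM mulf_neq0.
- split.
    rewrite addf_div ?tofrac_eq0 ?tofracD ?tofracM //;
      exact: (ev_neq0 (ev := eval_at z)).
  by rewrite weightD !weight_invariantM // pz rz !mul0r !addr0 mevalM addf_div.
Qed.

Lemma has_derivative0 : has_derivative w 0 0.
Proof.
exists 0, 1; rewrite meval0 meval1 oner_neq0; split=> //.
- by move=> mu; rewrite msupp0.
- by move=> mu; rewrite msupp1 inE => /eqP ->; exists 0 => i _; rewrite mnm0E pairing0l.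
- by split; [rewrite tofrac0|rewrite weight0]; rewrite mul0r.
Qed.

Lemma has_derivative_sum (I : Type) (r : seq I) (f : I -> K) (g : I -> C) :
  (forall i, has_derivative w (f i) (g i)) ->
  has_derivative w (\sum_(i <- r) f i) (\sum_(i <- r) g i).
Proof.
move=> H; elim/big_rec2: _ => [|i y x _]; first exact: has_derivative0.
exact: has_derivativeD.
Qed.

Lemma max_ideal_derivative x : max_ideal e z x -> exists a, has_derivative w x a.
Proof.
move=> [b [p [q [gp gq pz qz ex]]]]; exists (weight w p / q.@[z]), p, q; split=> //.
  exact: (graded_invariant gp gq qz).
exact: (graded_invariant gq gq qz).
Qed.

End Derivative.

(** The scalar a is the value of x at [z], the same for every w: this makes the functionals linear
    forms on the cotangent space. *)
Lemma local_ring_derivative x : OZ x -> exists a, forall w y b, point_derivation w ->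
  has_derivative w y b -> has_derivative w (x * y) (a * b).
Proof.
move=> [b [r [s [gr gs sz ->]]]]; exists (r.@[z] / s.@[z]) => w y c dw.
move=> [p [q [hp hq pz qz [-> ->]]]].
have hr := graded_invariant gr gs sz; have hs := graded_invariant gs gs sz.
exists (r * p), (s * q); split; [exact: invariantM|exact: invariantM|..].
- by rewrite mevalM pz mulr0.
- by rewrite mevalM mulf_neq0.
- split; first by rewrite mulf_div !tofracM.
  by rewrite weight_invariantM // pz mulr0 add0r mevalM mulf_div.
Qed.

(* In other words, d + 1 independent functionals on the cotangent space at [z]
   exclude smoothness. *)
Lemma smooth_cotangent (w : 'I_d -> 'X_{1..n} -> C) w' (x : 'I_d -> K) x'
    (a : 'I_d -> C) (y : C) :
  smooth_point e z -> (forall j, point_derivation (w j)) -> point_derivation w' ->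
  (forall j, max_ideal e z (x j)) -> max_ideal e z x' ->
  (forall j k, has_derivative (w k) (x j) (if j == k then a j else 0)) ->
  (forall j, a j != 0) ->
  (forall k, has_derivative (w k) x' 0) -> has_derivative w' x' y -> y = 0.
Proof.
move=> [t tm tgen] dw dw' xm xm' Dx a0 Dx' Dy.
have tD k j := max_ideal_derivative (w k) (tm j).
have tD' j := max_ideal_derivative w' (tm j).
pose g k j := projT1 (cid (tD k j)); pose g' j := projT1 (cid (tD' j)).
have gP k j : has_derivative (w k) (t j) (g k j) by rewrite /g; case: cid.
have gP' j : has_derivative w' (t j) (g' j) by rewrite /g'; case: cid.
have expand u : max_ideal e z u -> exists c : 'I_d -> C,
    (forall k, has_derivative (w k) u (\sum_j c j * g k j)) /\
    has_derivative w' u (\sum_j c j * g' j).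
  move=> /tgen [c cl ->]; have H j := local_ring_derivative (cl j).
  exists (fun j => projT1 (cid (H j))); split=> [k|];
    by apply: has_derivative_sum => // j; case: cid => /= b hb; apply: hb.
have X j := expand _ (xm j).
pose A := \matrix_(j, l) projT1 (cid (X j)) l.
pose G := \matrix_(l, k) g k l.
(* [A] expresses the x_j in the generators t_l, and [G] holds the values of the w_k on the t_l. The
   product is invertible, so [G] is, and a class killed by all the w_k has zero coordinates. *)
have AG : A *m G = diag_mx (\row_j a j).
  apply/matrixP => j k; rewrite !mxE.
  have -> : (a j *+ (j == k)) = (if j == k then a j else 0) by rewrite mulrb.
  apply: (has_derivative_uniq (dw k) _ (Dx j k)).
  have := (projT2 (cid (X j))).1 k; congr (has_derivative _ _ _).
  by apply: eq_bigr => l _; rewrite !mxE.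
have uG : G \in unitmx.
  rewrite unitmxE unitfE; apply: contra_neq (_ : \prod_j a j != 0) => [G0|].
    have /(congr1 determinant) := AG; rewrite det_mulmx G0 mulr0 det_diag => ->.
    by apply: eq_bigr => j _; rewrite mxE.
  by apply/prodf_neq0.
have [c [cw cw']] := expand _ xm'.
have : (\row_j c j) *m G = 0.
  apply/rowP => k; rewrite !mxE; apply: (has_derivative_uniq (dw k) _ (Dx' k)).
  have := cw k; congr (has_derivative _ _ _).
  by apply: eq_bigr => l _; rewrite !mxE.
move/(congr1 (mulmx^~ (invmx G))); rewrite mulmxK // mul0mx => /rowP c0.
apply: (has_derivative_uniq dw' Dy); move: cw'; congr (has_derivative _ _ _).
by apply: big1 => j _; have := c0 j; rewrite !mxE => ->; rewrite mul0r.
Qed.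

End Cotangent.

(** Cramer's rule over Z: the columns of the adjugate are dual to the e_i of I up to the
    determinant, which may differ from 1 and -1. *)
Lemma dual_vectors d n (e : 'I_n -> 'rV[int]_d) (I : dsubset d n) :
  exists r : 'I_d -> 'rV[int]_d, forall k l, pairing (r k) (e (idx I l)) =
    \det (\matrix_(k < d, j < d) e (idx I k) 0 j) *+ (k == l).
Proof.
set M := \matrix_(_, _) _; exists (fun k => (col k (\adj M))^T) => k l.
have /matrixP/(_ l k) := mul_mx_adj M; rewrite [in RHS]mxE eq_sym => <-.
by rewrite !mxE; apply: eq_bigr => j _; rewrite !mxE mulrC.
Qed.

(** * From smoothness to dual vectors in the lattice *)

Section TangentFunctionals.
Context (R : realType) (d n : nat) (e : 'I_n -> 'rV[int]_d) (z : 'I_n -> R[i]).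
Local Notation C := R[i].
Local Notation S := {mpoly C[n]}.
Local Notation K := {fraction S}.
Local Notation T m := (laurent R (alpha e m)).
Local Notation cst c := ((c%:MP : S)%:F).
Local Notation zv mu := (('X_[mu] : S).@[z]).
Local Notation nonneg := (nonneg e z).
Implicit Types (m : 'rV[int]_d) (mu nu : 'X_{1..n}).

(** The characters that are units at [z]. *)
Definition null m := forall i, z i = 0 -> pairing m (e i) = 0.

(* Irreducible elements, up to units, of the monoid of characters that are
   regular at [z].  The functional coef_weight m below, which extracts the
   coefficient at m after evaluating the nonvanishing coordinates at z,
   satisfies the Leibniz rule precisely because m is irreducible. *)
Definition irreducible m := [/\ nonneg m, ~ null m &
  forall k l, nonneg k -> nonneg l -> null (k + l - m) -> null k \/ null l].

Definition agrees m mu := [forall i, (z i == 0) ==> ((mu i)%:Z == pairing m (e i))].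

Definition unit_part mu : C := \prod_(i | z i != 0) z i ^+ mu i.

Definition coef_weight m mu : C := (agrees m mu)%:R * unit_part mu.

(** The field z_i d/dz_i followed by evaluation at z: a derivation along the torus orbit. *)
Definition tangent_weight i mu : C := (mu i)%:R * zv mu.

Lemma agreesP m mu : reflect (forall i, z i = 0 -> (mu i)%:Z = pairing m (e i)) (agrees m mu).
Proof.
apply: (iffP forallP) => [H i zi|H i]; first by have := H i; rewrite zi eqxx => /eqP.
by apply/implyP => /eqP /H ->.
Qed.

Lemma unit_partD mu nu : unit_part (mu + nu)%MM = unit_part mu * unit_part nu.
Proof. by rewrite /unit_part -big_split; apply: eq_bigr => i _; rewrite mnmDE exprD. Qed.

Lemma unit_part_neq0 mu : unit_part mu != 0.
Proof. by apply/prodf_neq0 => i zi; rewrite expf_neq0. Qed.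

Lemma zvE mu : zv mu = coef_weight 0 mu.
Proof.
rewrite mevalX (bigID (fun i => z i == 0)) /=; congr (_ * _).
have [/agreesP H|/agreesP H] := boolP (agrees 0 mu).
  by apply: big1 => i /eqP zi; have := H i zi; rewrite pairing0l => -[->].
apply/eqP; apply: contra_notT H => nz i zi; rewrite pairing0l.
have /prodf_neq0/(_ i) := nz; rewrite zi eqxx => /(_ isT).
by case: (mu i) => // k; rewrite exprS mul0r eqxx.
Qed.

Lemma zvD mu nu : zv (mu + nu)%MM = zv mu * zv nu.
Proof. by rewrite mpolyXD mevalM. Qed.

Lemma tangent_weight_derivation i : point_derivation e z (tangent_weight i).
Proof. by move=> mu nu _ _; rewrite /tangent_weight zvD mnmDE natrD; ring. Qed.

Lemma coef_weight_derivation m : irreducible m -> point_derivation e z (coef_weight m).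
Proof.
move=> [nm nz irr] mu nu [k hk] [l hl]; rewrite !zvE /coef_weight unit_partD.
(* By irreducibility, if mu + nu agrees with m then one summand agrees with 0 and the other with m.
   As m is not null, the two cases exclude each other, so the Leibniz sum has at most one nonzero
   term. *)
suff -> : agrees m (mu + nu)%MM = (agrees m mu && agrees 0 nu) || (agrees 0 mu && agrees m nu).
  have excl f : agrees m f -> agrees 0 f -> False.
    move=> /agreesP h /agreesP h0; apply: nz => i zi; rewrite -h // h0 //.
    by rewrite pairing0l.
  have := excl mu; have := excl nu.
  case: (agrees m mu); case: (agrees 0 mu); case: (agrees m nu); case: (agrees 0 nu) => /= h1 h2;
    try (by case: h1); try (by case: h2); ring.
have nonnegE (f : 'X_{1..n}) g : (forall i, z i = 0 -> (f i)%:Z = pairing g (e i)) -> nonneg g.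
  by move=> h i zi; rewrite -h.
have pm0 : pairing 0 =1 (fun=> 0 : int) by move=> v; apply: pairing0l.
apply/agreesP/orP => [h|].
  have nkl : null (k + l - m).
    by move=> i zi; rewrite !pairingDl pairingNl -h // -hk // -hl // mnmDE PoszD subrr.
  have [nk|nl] := irr _ _ (nonnegE _ _ hk) (nonnegE _ _ hl) nkl; [right|left].
    apply/andP; split; apply/agreesP => i zi; first by rewrite pm0 hk // nk.
    by rewrite -h // mnmDE hl // PoszD hk // nk // add0r hl.
  apply/andP; split; apply/agreesP => i zi; last by rewrite pm0 hl // nl.
  by rewrite -h // mnmDE PoszD [in RHS]hl // nl // addr0.
by case=> /andP[/agreesP h /agreesP h'] i zi; rewrite mnmDE PoszD h // h' // pm0 ?addr0 ?add0r.
Qed.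

Section Characters.
Variable m : 'rV[int]_d.
Hypothesis nm : nonneg m.
Let pos := pos_part (alpha e m).
Let neg := pos_part (- alpha e m).

Lemma pos_pairing i : z i = 0 -> (pos i)%:Z = pairing m (e i).
Proof.
by move=> zi; rewrite mnmE mxE; have := nm zi; case: (pairing m (e i)).
Qed.

Lemma neg_pairing i : z i = 0 -> neg i = 0%N.
Proof.
by move=> zi; rewrite mnmE !mxE; have := nm zi; case: (pairing m (e i)) => [[|k]|k].
Qed.

Lemma pos_neg i : (pos i)%:Z - (neg i)%:Z = pairing m (e i).
Proof. by have /rowP/(_ i) := pos_partB (alpha e m); rewrite !mxE. Qed.

Definition Tval : C := zv pos / zv neg.

(** The value of t^m at z with the vanishing coordinates left out; unlike [Tval] it is never 0. *)
Definition Tunit : C := unit_part pos / unit_part neg.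

Lemma zv_neg : zv neg = unit_part neg.
Proof.
rewrite zvE /coef_weight; case: agreesP => [_|[]]; first by rewrite mul1r.
by move=> i zi; rewrite neg_pairing // pairing0l.
Qed.

Lemma zv_neg_neq0 : zv neg != 0.
Proof. by rewrite zv_neg unit_part_neq0. Qed.

Lemma Tunit_neq0 : Tunit != 0.
Proof. by rewrite mulf_neq0 ?invr_neq0 ?unit_part_neq0. Qed.

Lemma TvalE : Tval = if `[< null m >] then Tunit else 0.
Proof.
rewrite /Tval /Tunit zv_neg zvE /coef_weight; case: asboolP => H; case: agreesP => H'.
- by rewrite mul1r.
- by case: H' => i zi; rewrite pos_pairing // H // pairing0l.
- by case: H => i zi; rewrite -pos_pairing // H' // pairing0l.
- by rewrite !mul0r.
Qed.

Let x := T m - cst Tval.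

Let x_num : S := 'X_[pos] - Tval *: 'X_[neg].

Let x_frac : x = x_num%:F / ('X_[neg] : S)%:F.
Proof.
rewrite /x /x_num tofracB -mul_mpolyC tofracM mulrBl mulfK //.
by rewrite tofrac_eq0 mpolyX_neq0.
Qed.

Let x_num0 : x_num.@[z] = 0.
Proof. by rewrite /x_num mevalB mevalZ divfK ?subrr ?zv_neg_neq0. Qed.

Lemma character_max_ideal : max_ideal e z (T m - cst Tval).
Proof.
apply/max_idealE; split.
  by rewrite -tofracN -mpolyCN; apply: function_fieldD;
    [exact: function_field_laurent|exact: function_fieldC].
by rewrite -/x x_frac; exists x_num, 'X_[neg]; rewrite /= x_num0 zv_neg_neq0.
Qed.

Lemma character_derivative w :
  has_derivative e z w (T m - cst Tval) ((w pos - Tval * w neg) / zv neg).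
Proof.
have iX (f : 'X_{1..n}) k : (forall i, z i = 0 -> (f i)%:Z = pairing k (e i)) ->
    invariant_poly e z ('X_[f] : S).
  by move=> h mu; rewrite msuppX inE => /eqP ->; exists k.
have ineg : invariant_poly e z ('X_[neg] : S).
  by apply: (iX _ 0) => i zi; rewrite neg_pairing // pairing0l.
exists x_num, 'X_[neg]; split=> //; first last.
- split; first exact: x_frac.
  congr (_ / _); rewrite /x_num weightD -[- (Tval *: 'X_[neg])]scaleNr weightZX mulNr.
  by rewrite -['X_[pos]]scale1r weightZX mul1r.
- exact: zv_neg_neq0.
apply: invariantD; first by apply: iX => i zi; rewrite pos_pairing.
by move=> mu; rewrite -scaleNr => /msuppZ_le; apply: ineg.
Qed.

(** A regular character that is not a unit at [z] vanishes there, and so does its derivative along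
    the orbit. *)
Lemma character_tangent_weight i : has_derivative e z (tangent_weight i) (T m - cst Tval)
  (if `[< null m >] then (pairing m (e i))%:~R * Tunit else 0).
Proof.
have := character_derivative (tangent_weight i); congr (has_derivative _ _ _ _).
have -> : tangent_weight i pos = (pos i)%:R * (Tval * zv neg).
  by rewrite /tangent_weight divfK ?zv_neg_neq0.
rewrite /tangent_weight [Tval * (_ * _)]mulrCA -mulrBl mulrA mulfK ?zv_neg_neq0 //.
rewrite -(pos_neg i) rmorphB /= TvalE; case: ifP => // _; first by rewrite mulr0.
Qed.

(** The denominator of t^m has exponent 0 on the vanishing coordinates, so the functional kills it
    when k is not null; what remains detects whether m and k agree there. *)
Lemma character_coef_weight k : ~ null k -> has_derivative e z (coef_weight k) (T m - cst Tval)
  (if `[< null (m - k) >] then Tunit else 0).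
Proof.
move=> nk; have := character_derivative (coef_weight k); congr (has_derivative _ _ _ _).
have -> : coef_weight k neg = 0.
  rewrite /coef_weight; case: agreesP => [H|_]; last by rewrite mul0r.
  by case: nk => i zi; rewrite -H // neg_pairing.
rewrite mulr0 subr0 zv_neg /coef_weight /Tunit.
case: asboolP => H; case: agreesP => H'.
- by rewrite mul1r.
- case: H' => i zi; rewrite pos_pairing //; apply/eqP.
  by rewrite -subr_eq0 -pairingNl -pairingDl H.
- by case: H => i zi; rewrite pairingDl pairingNl -pos_pairing // H' // subrr.
- by rewrite !mul0r.
Qed.

End Characters.

Lemma nullB k l : null (k - l) <-> forall i, z i = 0 -> pairing k (e i) = pairing l (e i).
Proof.
split=> H i zi; last by rewrite pairingDl pairingNl H // subrr.
by apply/eqP; rewrite -subr_eq0 -pairingNl -pairingDl H.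
Qed.

Section Cone.
Variable I : dsubset d n.
Hypothesis zI : forall i, z i = 0 -> i \in val I.
Local Notation D := (\det (\matrix_(k < d, j < d) e (idx I k) 0 j)).
Hypothesis D0 : D != 0.

Lemma zero_idx i : z i = 0 -> exists k : 'I_d, i = idx I k.
Proof. by move/zI; rewrite -mem_idx => /mapP[k _ ->]; exists k. Qed.

(** The element taken has the least positive value at e_i among those vanishing on the other
    relevant rays; the dual vectors show that there are some. In a decomposition both summands lie
    on the same axis, so by minimality one of them has value 0. *)
Lemma irreducible_axis i : z i = 0 -> exists m, irreducible m /\
  exists2 c : int, 0 < c & forall i', z i' = 0 -> pairing m (e i') = c *+ (i' == i).
Proof.
move=> zi; have [r rP] := dual_vectors e I.
pose P c := (0 < c)%N && `[< exists m, forall i', z i' = 0 ->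
  pairing m (e i') = c%:Z *+ (i' == i) >].
have exP : exists c, P c.
  exists `|D|%N; rewrite /P absz_gt0 D0; apply/asboolP.
  have [k ->] := zero_idx zi; exists (sgz D *: r k) => i' zi'.
  have [l ->] := zero_idx zi'; rewrite pairingZl rP (inj_eq (@idx_inj _ _ I)) [l == k]eq_sym.
  by rewrite mulrnAr -abszEsg.
case: (ex_minnP exP) => c /andP[c0 /asboolP [m hm]] cmin.
exists m; split; last by exists c%:Z.
split=> [i' zi'|null_m|k l nk nl /nullB H].
- by rewrite hm // mulrn_wge0.
- by have := null_m i zi; rewrite hm // eqxx => -[] c1; rewrite c1 in c0.
have Hz i' : z i' = 0 -> i' != i -> pairing k (e i') = 0 /\ pairing l (e i') = 0.
  move=> zi' /negPf ne; have := H i' zi'; rewrite hm // ne pairingDl mulr0n.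
  by have := nk i' zi'; have := nl i' zi'; lia.
have [k0|k0] := eqVneq (pairing k (e i)) 0.
  by left=> i' zi'; have [->//|ne] := eqVneq i' i; have [] := Hz i' zi' ne.
have [l0|l0] := eqVneq (pairing l (e i)) 0.
  by right=> i' zi'; have [->//|ne] := eqVneq i' i; have [] := Hz i' zi' ne.
have /cmin : P `|pairing k (e i)|%N.
  rewrite /P absz_gt0 k0; apply/asboolP; exists k => i' zi'.
  rewrite gez0_abs ?nk //; have [->|ne] := eqVneq i' i; first by rewrite mulr1n.
  by rewrite mulr0n; have [] := Hz i' zi' ne.
have := H i zi; rewrite hm // eqxx mulr1n pairingDl.
by have := nk i zi; have := nl i zi; lia.
Qed.

(** Among the regular characters with value 1 at e_i, one of least total height is taken. In a
    decomposition one summand again has value 1 at e_i, so it carries the whole height and the other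
    is null. *)
Lemma irreducible_height1 i : z i = 0 -> primitive (e i) ->
  exists m, irreducible m /\ pairing m (e i) = 1.
Proof.
move=> zi pe; have [r rP] := dual_vectors e I.
pose ht m := \sum_(i | z i == 0) pairing m (e i).
have ht_ge0 m : nonneg m -> 0 <= ht m.
  by move=> nm; apply: sumr_ge0 => i' /eqP; apply: nm.
pose P s := `[< exists m, [/\ nonneg m, pairing m (e i) = 1 & ht m = s%:Z] >].
have exP : exists s, P s.
  have [C _ [j0 hC]] := primitive_unimodular pe; pose m0 := row j0 C.
  (* [m0] may be negative on other rays. There [m1] adds |<m0, e>| D^2, which is enough whatever the
     sign of D, and it adds 0 at e_i. *)
  pose m1 := \sum_(k | (z (idx I k) == 0) && (idx I k != i))
     (`|pairing m0 (e (idx I k))| * D) *: r k.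
  have m1P i' : z i' = 0 -> pairing m1 (e i') =
      if i' == i then 0 else `|pairing m0 (e i')| * D * D.
    move=> zi'; have [l el] := zero_idx zi'; rewrite el pairing_suml.
    rewrite big_mkcond (bigD1 l) //= -el zi' eqxx big1 ?addr0 /=.
      by case: eqP => // _; rewrite pairingZl el rP eqxx mulr1n.
    by move=> k /negPf kl; case: ifP => // _; rewrite el pairingZl rP kl mulr0n mulr0.
  have m01 : pairing m0 (e i) = 1 by rewrite hC eqxx.
  have nn : nonneg (m0 + m1).
    move=> i' zi'; rewrite pairingDl m1P //; have [->|_] := eqVneq i' i.
      by rewrite m01 addr0.
    have D1 : 1 <= D * D by rewrite -gtz0_ge1 -expr2 exprn_even_gt0.
    by move: (pairing m0 _) D1 => a; rewrite -mulrA; move: (D * D) => b; nia.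
  exists `|ht (m0 + m1)%R|%N; apply/asboolP; exists (m0 + m1); split=> //.
    by rewrite pairingDl m1P // eqxx m01 addr0.
  by rewrite gez0_abs // ht_ge0.
case: (ex_minnP exP) => s /asboolP [m [nm m1 hs]] smin.
exists m; split=> //; split=> // [nz|k l nk nl /nullB H].
  by have := nz i zi; rewrite m1.
have htE : ht k + ht l = s%:Z.
  rewrite -hs /ht -big_split; apply: eq_bigr => i' /eqP zi'.
  by rewrite -H // pairingDl.
have aux k' l' : nonneg k' -> nonneg l' -> ht k' + ht l' = s%:Z ->
    pairing k' (e i) = 1 -> null l'.
  move=> nk' nl' hkl k1.
  have /smin : P `|ht k'|%N.
    by apply/asboolP; exists k'; rewrite gez0_abs ?ht_ge0.
  have := ht_ge0 _ nk'; have := ht_ge0 _ nl' => h1 h2 h3.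
  have : ht l' == 0 by apply/eqP; lia.
  rewrite psumr_eq0 => [/allP z0 i' zi'|i' /eqP /nl' //].
  by have := z0 i'; rewrite mem_index_enum zi' eqxx => /(_ isT)/eqP.
have := H i zi; rewrite pairingDl m1; have := nk i zi; have := nl i zi.
move=> li ki kl1; have [k1|l1] : pairing k (e i) = 1 \/ pairing l (e i) = 1 by lia.
  by right; apply: (aux k l).
by left; apply: (aux l k) => //; rewrite addrC.
Qed.

(* The irreducible elements on the axes and the tangent directions of the orbit
   give d independent functionals; an irreducible m with <m, e_i> = 1 adds
   another one unless it lies on the i-th axis. *)
Lemma smooth_dual i : smooth_point e z -> z i = 0 -> primitive (e i) ->
  exists m, forall i', z i' = 0 -> pairing m (e i') = (i' == i)%:R.
Proof.
move=> smz zi pe; apply: contrapT => Hno.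
have [r rP] := dual_vectors e I.
have [m' [irr' m'1]] := irreducible_height1 zi pe.
have nm' : nonneg m' by case: irr'.
have nz' : ~ null m' by case: irr'.
pose A j m := (z (idx I j) = 0 -> irreducible m /\ exists2 c : int, 0 < c &
    forall i', z i' = 0 -> pairing m (e i') = c *+ (i' == idx I j)) /\
  (z (idx I j) != 0 -> m = r j).
have /choice [am amP] : forall j, exists m, A j m.
  move=> j; have [zj|zj] := eqVneq (z (idx I j)) 0.
    by have [m hm] := irreducible_axis zj; exists m; split=> // /eqP.
  by exists (r j); split=> // zj'; rewrite zj' eqxx in zj.
have rnull j : z (idx I j) != 0 -> null (r j).
  move=> zj i' zi'; have [l el] := zero_idx zi'; rewrite el rP.
  by have [jl|//] := eqVneq j l; rewrite jl -el zi' eqxx in zj.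
have nam j : nonneg (am j).
  have [h1 h2] := amP j; have [zj|zj] := eqVneq (z (idx I j)) 0.
    by have [[]] := h1 zj.
  by rewrite h2 // => i' zi'; rewrite rnull.
pose w j := if z (idx I j) == 0 then coef_weight (am j) else tangent_weight (idx I j).
pose a j := (if z (idx I j) == 0 then 1 else D%:~R) * Tunit (am j).
(* This is the value of the extra functional [coef_weight m'] on t^m' minus its value at z, an
   element killed by all d functionals [w]. *)
have : Tunit m' = 0; last by apply/eqP/Tunit_neq0.
apply: (@smooth_cotangent _ _ _ e z w (coef_weight m')
  (fun j => T (am j) - cst (Tval (am j))) (T m' - cst (Tval m')) a) => //.
- move=> j; rewrite /w; case: eqP => zj; last exact: tangent_weight_derivation.
  by apply: coef_weight_derivation; have [] := (amP j).1 zj.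
- exact: coef_weight_derivation.
- by move=> j; apply: character_max_ideal.
- exact: character_max_ideal.
- move=> j k; rewrite /w; have [zk|zk] := eqVneq (z (idx I k)) 0.
    have [irk [ck ck0 hk]] := (amP k).1 zk.
    have nk : ~ null (am k) by case: irk.
    have := character_coef_weight (nam j) nk; congr (has_derivative _ _ _ _ _).
    have [->|jk] := eqVneq j k.
      rewrite /a zk eqxx mul1r; case: asboolP => // -[]; apply/nullB => //.
    case: asboolP => // /nullB/(_ _ zk); rewrite hk // eqxx mulr1n.
    have [zj|zj] := eqVneq (z (idx I j)) 0.
      have [_ [cj _ hj]] := (amP j).1 zj; rewrite hj // (inj_eq (@idx_inj _ _ I)).
      by rewrite [k == j]eq_sym (negPf jk) => ck1; rewrite -ck1 ltxx in ck0.
    by rewrite (amP j).2 // rP (negPf jk) => ck1; rewrite -ck1 ltxx in ck0.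
  have := character_tangent_weight (nam j) (idx I k); congr (has_derivative _ _ _ _ _).
  have [->|jk] := eqVneq j k.
    rewrite /a (negPf zk) (amP k).2 //; case: asboolP => [_|[]]; last exact: rnull.
    by rewrite rP eqxx.
  have [zj|zj] := eqVneq (z (idx I j)) 0.
    by case: asboolP => // nj; have [[_ []]] := (amP j).1 zj.
  by rewrite (amP j).2 // rP (negPf jk) mulr0n mul0r if_same.
- move=> j; rewrite /a mulf_neq0 ?Tunit_neq0 //.
  by case: ifP; rewrite ?oner_neq0 // intr_eq0.
- move=> k; rewrite /w; have [zk|zk] := eqVneq (z (idx I k)) 0.
    have [irk [ck ck0 hk]] := (amP k).1 zk.
    have nk : ~ null (am k) by case: irk.
    have := character_coef_weight nm' nk; congr (has_derivative _ _ _ _ _).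
    (* If m' agreed with the irreducible element of an axis, the value 1 at e_i would make it the
       i-th axis, and m' would be the dual vector excluded by [Hno]. *)
    case: asboolP => // /nullB nkm; case: Hno; exists m' => i' zi'.
    have := nkm i zi; rewrite m'1 hk //; have [ei|_] := eqVneq i (idx I k); last first.
      by rewrite mulr0n.
    by rewrite mulr1n => ck1; rewrite nkm // hk // -ck1 -ei.
  have := character_tangent_weight nm' (idx I k); congr (has_derivative _ _ _ _ _).
  by case: asboolP.
have := character_coef_weight nm' nz'; congr (has_derivative _ _ _ _ _).
by case: asboolP => // -[]; apply/nullB.
Qed.

(** A nonzero determinant is asked, rather than a basis of M, because it enters the wedge of the
    characters as a constant; this leaves room for the r_j, dual up to D, at the nonvanishing
    coordinates. The sum 1 gives the product of the characters order 1 along each z_i = 0, as for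
    z_1 ... z_n. *)
Lemma smooth_frame : smooth_point e z -> (forall i, primitive (e i)) ->
  exists2 M : 'M[int]_d, \det M != 0 & forall i, z i = 0 ->
    (forall j, 0 <= pairing (row j M) (e i)) /\
    \sum_j pairing (row j M) (e i) = 1.
Proof.
move=> smz pe; have [r rP] := dual_vectors e I.
have /choice [v vP] : forall j, exists m,
    (z (idx I j) = 0 -> forall i, z i = 0 -> pairing m (e i) = (i == idx I j)%:R) /\
    (z (idx I j) != 0 -> m = r j).
  move=> j; have [zj|zj] := eqVneq (z (idx I j)) 0.
    by have [m hm] := smooth_dual smz zj (pe _); exists m; split=> // /eqP.
  by exists (r j); split=> // zj'; rewrite zj' eqxx in zj.
have vE j k : z (idx I k) = 0 -> pairing (v j) (e (idx I k)) = (j == k)%:R.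
  move=> zk; have [zj|zj] := eqVneq (z (idx I j)) 0.
    by rewrite (vP j).1 // (inj_eq (@idx_inj _ _ I)) eq_sym.
  rewrite (vP j).2 // rP; have [jk|//] := eqVneq j k.
  by rewrite jk zk eqxx in zj.
exists (\matrix_j v j) => [|i /[dup] zi /zero_idx [k ek]]; last first.
  have rE j : pairing (row j (\matrix_j v j)) (e i) = (j == k)%:R.
    by rewrite rowK ek vE // -ek.
  split=> [j|]; first by rewrite rE ler0n.
  rewrite (bigD1 k) //= rE eqxx big1 ?addr0 // => j /negPf jk.
  by rewrite rE jk.
pose E := \matrix_(k < d, j < d) e (idx I k) 0 j.
(* This matrix is block triangular: columns at nonvanishing coordinates are D times unit vectors,
   and the block at vanishing coordinates is the identity. *)
suff : \det (E *m (\matrix_j v j)^T) != 0.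
  by rewrite det_mulmx mulf_eq0 negb_or det_tr => /andP[].
apply/det0P => -[u /eqP u0 uE]; apply: u0.
have uE' j : \sum_k u 0 k * pairing (v j) (e (idx I k)) = 0.
  have /rowP/(_ j) := uE; rewrite !mxE => uEj; rewrite -[RHS]uEj.
  apply: eq_bigr => k _; congr (_ * _); rewrite mxE; apply: eq_bigr => l _.
  by rewrite !mxE mulrC.
have u1 j : z (idx I j) != 0 -> u 0 j = 0.
  move=> zj; have := uE' j; rewrite (vP j).2 // (bigD1 j) //= rP eqxx big1 ?addr0.
    by move/eqP; rewrite mulf_eq0 mulr1n (negPf D0) orbF => /eqP.
  by move=> k /negPf kj; rewrite rP eq_sym kj mulr0n mulr0.
apply/rowP => j; rewrite mxE; have [zj|/u1 //] := eqVneq (z (idx I j)) 0.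
rewrite -(uE' j) (bigD1 j) //= vE // eqxx mulr1 big1 ?addr0 // => k kj.
have [zk|/u1 ->] := eqVneq (z (idx I k)) 0; last by rewrite mul0r.
by rewrite vE // eq_sym (negPf kj) mulr0.
Qed.

End Cone.

End TangentFunctionals.

Lemma div_cancel (F : fieldType) (x y c : F) : y != 0 -> c != 0 ->
  x = x * y / c * (c / y).
Proof. by move=> y0 c0; rewrite mulrA divfK // mulfK. Qed.

Lemma mulKf_div (F : fieldType) (a x : F) : a != 0 -> a * x / a = x.
Proof. by move=> a0; field. Qed.

Lemma mulr_div_cancel (F : fieldType) (a u x : F) : a != 0 -> a * u * (x / a) = u * x.
Proof. by move=> a0; field. Qed.

Lemma unit_cancel (F : fieldType) (a y v c t : F) : v != 0 -> c != 0 -> t != 0 ->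
  v^-1 * (c^-1 * t^-1) * (a * v * y * (c * t)) = a * y.
Proof. by move=> v0 c0 t0; field; rewrite ?v0 ?c0 ?t0. Qed.

Lemma clear_denominators (F : fieldType) (a p q x : F) : q != 0 -> x != 0 ->
  a * (p / q / x) * (x * q) = a * p.
Proof. by move=> q0 x0; field; rewrite ?q0 ?x0. Qed.

(** * Sections of the twisted sheaf *)

Section ToricForms.
Context (R : realType) (d n : nat) (e : 'I_n -> 'rV[int]_d) (B : 'M[int]_d).
Hypothesis uB : B \in unitmx.
Local Notation C := R[i].
Local Notation S := {mpoly C[n]}.
Local Notation K := {fraction S}.
Local Notation gr := (graded_part (R := R) e).
Local Notation ff := (function_field (R := R) e).
Local Notation PX := ((\prod_(i < n) 'X_i : S)%:F).
Local Notation Om := (Omega0 R e B).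
Local Notation T m := (laurent R (alpha e m)).
Implicit Types (p q f A : S) (x y u : K) (z : 'I_n -> C).

Lemma intr_tofrac (k : int) : k%:~R = ((k%:~R : C)%:MP : S)%:F.
Proof. by rewrite !rmorph_int. Qed.

Lemma regular_unit_regular z u : regular_unit z u -> regular (eval_at z) u.
Proof. by move=> [p [q [_ qz ->]]]; exists p, q. Qed.

Lemma regular_unitV z u : regular_unit z u -> regular (eval_at z) u^-1.
Proof. by move=> [p [q [pz qz ->]]]; exists q, p; rewrite invf_div. Qed.

Lemma regular_unit_neq0 z u : regular_unit z u -> u != 0.
Proof.
move=> [p [q [pz qz ->]]].
by rewrite mulf_neq0 ?invr_eq0 // tofrac_eq0; apply: (ev_neq0 (ev := eval_at z)).
Qed.

Lemma regular_unit_int z (k : int) : k != 0 -> regular_unit z k%:~R.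
Proof.
move=> k0; exists (k%:~R%:MP), 1; rewrite mevalC meval1 intr_eq0 k0 oner_neq0.
by rewrite tofrac1 divr1 -intr_tofrac.
Qed.

Lemma detB_neq0 : \det B != 0.
Proof. by apply: contraTneq uB => B0; rewrite unitmxE B0 unitr0. Qed.

Lemma det_pairing (I : dsubset d n) :
  \det (\matrix_(j < d, k < d) pairing (row j B) (e (idx I k))) =
  \det B * \det (\matrix_(k < d, j < d) e (idx I k) 0 j).
Proof.
rewrite -[X in _ * X]det_tr -det_mulmx; congr (\det _); apply/matrixP => j k.
by rewrite !mxE; apply: eq_bigr => l _; rewrite !mxE.
Qed.

Lemma graded_prodX : gr (beta0 n) (\prod_(i < n) 'X_i).
Proof.
have -> : \prod_(i < n) 'X_i = 'X_[[multinom 1%N | i < n]] :> S.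
  by rewrite mpolyXE_id; apply: eq_bigr => i _; rewrite mnmE expr1.
have -> : beta0 n = exponents [multinom 1%N | i < n].
  by apply/rowP => i; rewrite !mxE mnmE.
exact: graded_mono.
Qed.

Lemma regular_dform_coef z (w : dform R d n) (I : dsubset d n) :
  regular_dform e z w -> regular (eval_at z) (w I).
Proof.
move=> [r [g [h [gl hl ->]]]]; rewrite sum_ffunE; apply: regular_sum => l _.
rewrite ffunE; apply: regularM; first by have /local_ringE[] := gl l.
rewrite ffunE; apply: regular_det => j k; rewrite mxE; apply: regular_pderiv.
by have /local_ringE[] := hl l j.
Qed.

Lemma regular_Omega0 z x : smooth_point e z -> (forall i, primitive (e i)) ->
  (exists2 I : dsubset d n, forall i, z i = 0 -> i \in val I &
     \det (\matrix_(k < d, j < d) e (idx I k) 0 j) != 0) ->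
  ff (x * PX) -> regular (eval_at z) x -> regular_dform e z (x *: Om).
Proof.
move=> smz pe [I zI D0] fx rx; have [M M0 hM] := smooth_frame zI D0 smz pe.
pose N := M *m invmx B.
have N0 : \det N != 0.
  by rewrite det_mulmx det_inv; apply: mulf_neq0 M0 (invr_neq0 detB_neq0).
pose P := \prod_j T (row j M); pose a : 'rV[int]_n := \sum_j alpha e (row j M).
have PE : P = laurent R a.
  by rewrite /P /a; elim/big_rec2: _ => [|j y y' _ ->]; rewrite ?laurent0 ?laurentD.
have P0 : P != 0 by rewrite PE laurent_neq0.
have NK0 : (\det N)%:~R != 0 :> K by apply: (@regular_unit_neq0 z); apply: regular_unit_int.
have -> : x *: Om = (x * PX / (P * (\det N)%:~R)) *: wedge_d (fun j => T (row j M)).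
  rewrite (wedge_characters R e uB) scalerA -/P -/N; congr (_ *: _).
  exact: (div_cancel x (PX_neq0 _ _) (mulf_neq0 P0 NK0)).
have nM j : nonneg e z (row j M) by move=> i zi; have [H _] := hM i zi; apply: H.
apply: (@forms_over1 R d n (local_ring e z)); last first.
  by move=> j; apply: local_ringT.
apply/local_ringE; split.
  apply: function_fieldM => //; apply: function_fieldV; apply: function_fieldM;
    last exact: function_field_int.
  by apply: function_field_prod => j _; apply: function_field_laurent.
rewrite invfM mulrA; apply: regularM; last exact/regular_unitV/regular_unit_int.
(* On a vanishing coordinate the exponent of PX / P is 1 minus the sum of the pairings, that is
   0. *)
rewrite -mulrA; apply: regularM => //; rewrite prodXE PE -laurentN -laurentD.
apply: regular_laurent => i zi; rewrite !mxE summxE.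
have [_ s1] := hM i zi; rewrite (eq_bigr (fun j => pairing (row j M) (e i))) ?s1 ?subrr //.
by move=> j _; rewrite mxE.
Qed.

(** The component of A of class b has the same product with q as A itself, and q can be
    cancelled. *)
Lemma graded_quotient b c A p q : gr c q -> gr (b + c) p -> q != 0 -> A * q = p -> gr b A.
Proof.
move=> gq gp q0 e0; suff <- : component e b A = A by apply: graded_component.
by apply: (mulIf q0); rewrite -(componentM _ _ gq) e0 component_graded.
Qed.

Lemma rational_scale g (w : dform R d n) : ff g -> rational_dform e w -> rational_dform e
  (g *: w).
Proof. by move=> fg; apply: forms_overZ => // x y; apply: function_fieldM. Qed.

Lemma rational_Omega0 x : ff (x * PX) -> rational_dform e (x *: Om).
Proof.
move=> fx; rewrite -[x](mulfK (PX_neq0 R n)).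
have H := proj2 (rational_dformP e uB ((x * PX / PX) *: Om)).
by apply: H; exists (x * PX).
Qed.

End ToricForms.

(** * The two inclusions *)

Section Main.
Context (R : realType) (d n : nat) (B : 'M[int]_d)
    (Sigma : set (set 'rV[R]_d)) (e : 'I_n -> 'rV[int]_d)
    (b : 'rV[int]_n) (f : {mpoly R[i][n]}).
Hypotheses (uB : B \in unitmx)
  (fanS : is_fan Sigma) (simpS : simplicial Sigma) (compS : complete Sigma)
  (rayS : ray_generators Sigma e)
  (f0 : f != 0) (gf : graded_part e b f).
Local Notation C := R[i].
Local Notation S := {mpoly C[n]}.
Local Notation K := {fraction S}.
Local Notation ff := (function_field (R := R) e).
Local Notation PX := ((\prod_(i < n) 'X_i : S)%:F).
Local Notation Om := (Omega0 R e B).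
Implicit Types (A : S) (x : K) (z : 'I_n -> C).

Lemma basis_at z : U Sigma e z -> exists2 I : dsubset d n,
  forall i, z i = 0 -> i \in val I &
  \det (\matrix_(k < d, j < d) e (idx I k) 0 j) != 0.
Proof.
move=> Uz; have [I [sI D0]] := extend_to_basis fanS simpS compS rayS
  (free_zeros fanS simpS rayS Uz).
by exists I => // i zi; apply: sI; rewrite mem_enum inE zi.
Qed.

Lemma function_field_numerator A : graded_part e (b - beta0 n) A -> ff (A%:F / f%:F * PX).
Proof.
move=> gA; exists b, (A * \prod_(i < n) 'X_i), f; split=> //.
  by have := gradedM gA (@graded_prodX R d n e); rewrite subrK.
by rewrite tofracM mulrAC.
Qed.

Lemma Omega0_section A : is_cartier Sigma e f -> graded_part e (b - beta0 n) A ->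
  H0_Omega_d Sigma e f ((A%:F / f%:F) *: Om).
Proof.
move=> cart gA; have fx := function_field_numerator gA; set x := A%:F / f%:F in fx *.
have rat : rational_dform e (x *: Om).
  exact: rational_Omega0.
split=> // z Uz; have [h [g [hz leq]]] := cart z Uz.
exists h, g; split; [exact: hz|exact: leq|]; have [fg gu] := leq.
split; first exact: rational_scale.
move=> z' Uz' hz' smz'; rewrite scalerA; have [u ru eg] := gu z' Uz' hz'.
apply: regular_Omega0 => //; first by move=> i; apply: (ray_primitive rayS).
- exact: basis_at.
- by rewrite -mulrA; apply: function_fieldM.
rewrite eg /x mulr_div_cancel ?tofrac_eq0 //.
by apply: regularM; [exact: regular_unit_regular|exact: regular_tofrac].
Qed.

Lemma section_coef_regular x z : H0_Omega_d Sigma e f ((x / PX) *: Om) ->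
  (forall i j, z i = 0 -> z j = 0 -> i = j) -> regular (eval_at z) (f%:F * (x / PX)).
Proof.
move=> [_ loc] z1; have Uz := one_zero_in_U compS rayS z1.
have smz : smooth_point e z.
  by apply: smooth_one_zero => // i; apply: (ray_primitive rayS).
have [h [g [[_ hz] [fg gu] [_ reg]]]] := loc z Uz.
have [u ru eg] := gu z Uz hz; have [I zI D0] := basis_at Uz.
have := regular_dform_coef I (reg z Uz hz smz).
rewrite scalerA !ffunE /GRing.scale /= det_pairing eg.
set k := _ * \det _; set X := \prod_(i in _) _.
have rk : regular_unit z (k%:~R : K).
  by apply: regular_unit_int; apply: mulf_neq0 (detB_neq0 uB) D0.
have rX : regular_unit z X%:F.
  exists X, 1; rewrite meval1 oner_neq0 tofrac1 divr1; split=> //.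
  rewrite /X rmorph_prod; apply/prodf_neq0 => i; rewrite inE => iI.
  by rewrite /= mevalXU; apply: contraNneq iI => /zI.
have [u0 k0 X0] := And3 (regular_unit_neq0 ru) (regular_unit_neq0 rk) (regular_unit_neq0 rX).
(* The coefficient of the form at I is f x / PX times three units at z: u, the determinant and the
   monomial outside I. *)
rewrite -(unit_cancel f%:F (x / PX) u0 k0 X0); apply: regularM.
apply: regularM; first exact: regular_unitV.
by apply: regularM; apply: regular_unitV.
Qed.

Lemma section_is_Omega0 w : H0_Omega_d Sigma e f w ->
  exists2 A, graded_part e (b - beta0 n) A & (A%:F / f%:F) *: Om = w.
Proof.
move=> Hw; have [/(rational_dformP e uB) [x fx ew] _] := Hw.
rewrite ew in Hw *.
have [A eA] := regular_off_codim2 (fun z hz => section_coef_regular Hw hz).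
have fF0 : f%:F != 0 by rewrite tofrac_eq0.
exists A; last by rewrite -eA (mulKf_div _ fF0).
have [c [p [q [gp gq q0 ex]]]] := fx.
apply: (@graded_quotient _ _ _ _ _ (beta0 n + c) A (f * p) (\prod_(i < n) 'X_i * q)).
- by apply: gradedM => //; apply: graded_prodX.
- by rewrite addrA subrK; apply: gradedM.
- by rewrite mulf_neq0 // -tofrac_eq0 PX_neq0.
have q0' : q%:F != 0 by rewrite tofrac_eq0.
apply/eqP; rewrite -tofrac_eq !tofracM -eA ex.
by rewrite (clear_denominators _ _ q0' (PX_neq0 R n)).
Qed.

End Main.

Unset Implicit Arguments.
Local Open Scope classical_set_scope.

Theorem theorem9p7 (R : realType) (d n : nat) (B : 'M[int]_d)
    (Sigma : set (set 'rV[R]_d)) (e : 'I_n -> 'rV[int]_d)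
    (b : 'rV[int]_n) (f : {mpoly R[i][n]}) :
  B \in unitmx ->
  is_fan Sigma -> simplicial Sigma -> complete Sigma ->
  ray_generators Sigma e ->
  f != 0 -> graded_part e b f -> is_cartier Sigma e f ->
  H0_Omega_d Sigma e f =
  [set (FracField.tofrac A / FracField.tofrac f) *: Omega0 R e B
     | A in graded_part e (b - beta0 n)].
Proof.
move=> uB fanS simpS compS rayS f0 gf cart; apply/seteqP; split=> w /=.
  by move/(section_is_Omega0 uB fanS simpS compS rayS f0 gf) => [A gA <-]; exists A.
move=> [A gA <-].
exact: (Omega0_section uB fanS simpS compS rayS f0 gf cart gA).
Qed.
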